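(* Let $m,k$ be real constants with $k\geq m\geq 2$, and let $\gamma_1,\gamma_2,\gamma_3>0$ be real numbers such that either $$\gamma_1-\gamma_2-m^2\gamma_3-3m(k-1)\gamma_3-e(e+1)\geq e\sinh 1$$ or $$1-e-e\big(\gamma_1+\gamma_2+m^2\gamma_3+3m(k-1)\gamma_3\big)\geq e\sinh 1.$$ If $p$ is an analytic function in $\mathbb{D}$ such that $p(0)=1$ and $$p(z)+\gamma_1 zp'(z)+\gamma_2 z^2p''(z)+\gamma_3 z^3p'''(z)\prec 1+\sin z,$$ then $p(z)\prec e^z$.
   Context: $\mathbb{D}=\{z\in\mathbb{C}:|z|<1\}$ is the open unit disk. For analytic functions $g,h$ on $\mathbb{D}$, $g\prec h$ ($g$ is subordinate to $h$) means that there is an analytic function $w:\mathbb{D}\to\mathbb{D}$ with $w(0)=0$ and $|w(z)|\le|z|$ such that $g(z)=h(w(z))$ for all $z\in\mathbb{D}$. *)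

(* Defs.v *)
From Stdlib Require Import Reals.
From Coquelicot Require Import Coquelicot.

Definition unit_disk (z : C) : Prop := (Cmod z < 1)%R.

(* Functions on a domain U are represented by total functions on C. For U open,
   [analytic_on U f] and the derivatives of f at points of U depend only on the
   values of f on U; the radius r need not keep the ball inside U, but it may
   always be shrunk so that it does. *)
Definition analytic_on (U : C -> Prop) (f : C -> C) : Prop :=
  forall z0 : C, U z0 ->
    exists (a : nat -> C) (r : posreal),
      forall z : C, (Cmod (z - z0) < r)%R -> is_pseries a (z - z0)%C (f z).

Definition subordinate (g h : C -> C) : Prop :=
  exists w : C -> C,
    analytic_on unit_disk w /\
    (forall z : C, unit_disk z -> unit_disk (w z)) /\
    w (RtoC 0) = RtoC 0 /\
    (forall z : C, unit_disk z -> (Cmod (w z) <= Cmod z)%R) /\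
    (forall z : C, unit_disk z -> g z = h (w z)).

Definition Cexp (z : C) : C :=
  (exp (Re z) * cos (Im z), exp (Re z) * sin (Im z))%R.

Definition Csin (z : C) : C :=
  ((Cexp (Ci * z) - Cexp (- (Ci * z))) / (RtoC 2 * Ci))%C.

(* Main.v *)
Require Import Defs.
From Stdlib Require Import Reals.
From Coquelicot Require Import Coquelicot.
From Stdlib Require Import Lra Lia Psatz ClassicalEpsilon.

(** Why the theorem holds.

    The second alternative of the hypothesis never happens: its left-hand side
    is at most [1 - e < 0].  The first one forces [gamma1 >= 10]
    ([gamma1_ge_10]).

    Let [p = sum a_n z^n] and let [q] be the left-hand side of the
    subordination.  On coefficients the differential operator is diagonal: it
    multiplies [a_n] by
    [c_n = 1 + gamma1 n + gamma2 n(n-1) + gamma3 n(n-1)(n-2) >= 10 n].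
    Subordination to [1 + sin z] gives [|q - 1| <= 2], so Parseval bounds
    [sum |c_n a_n|^2] by 4, and Cauchy-Schwarz together with
    [sum 1/n^2 <= 2] yields [|p z - 1| <= |z| / 3]
    ([euler_operator_inverse_bound]).  Cauchy's estimates
    [|c_n a_n| <= 2] alone would not do, since [sum 1/n] diverges.  Finally
    [w = log p] is given by the logarithmic series ([complex_log]), and
    [|log (1 + u)| <= |u| / (1 - |u|)] with [|u| <= |z| / 3] gives
    [|w z| <= |z|]; so [p = exp w] is subordinate to [exp].

    The function theory behind this is developed without integrals.
    Analytic functions are infinitely differentiable by termwise
    differentiation ([analytic_Ck]).  The maximum principle
    ([maximum_principle]) comes from the positive Laplacian of
    [|F|^2 + eps |z|^2]; applied to [z F^n], it passes over an isolated
    singularity near which [F] is bounded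
    ([maximum_principle_punctured]).  For a polynomial [Q] of degree less than
    [N], averaging [f z * Q (r / z)] over the rotations by the [N]-th roots of
    unity cancels the pole and leaves a function whose limit at 0 is the
    pairing of the coefficients of [f] and [Q]; the maximum principle then gives
    [coefficient_functional_bound], which contains both Parseval's inequality
    and Cauchy's estimates.  With these estimates, the maximum principle for the
    Taylor remainder divided by [z^N] shows that the Taylor series of an
    infinitely differentiable function converges to it on the whole disk
    ([taylor_series_converges]), which is how [p] is expanded globally and
    how [w] is seen to be analytic ([Ck_analytic]). *)

Local Open Scope C_scope.

(** * Moduli of complex numbers *)

Lemma Cmod_sub_sym x y : Cmod (x - y) = Cmod (y - x).
Proof. rewrite <- Cmod_opp. f_equal. ring. Qed.

Lemma Cmod_triangle_sub x y : (Cmod (x - y) <= Cmod x + Cmod y)%R.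
Proof. unfold Cminus. rewrite <- (Cmod_opp y). apply Cmod_triangle. Qed.

Lemma Cmod_triangle_rev x y : (Cmod x - Cmod y <= Cmod (x - y))%R.
Proof.
pose proof (Cmod_triangle (x - y) y) as H.
replace (x - y + y) with x in H by ring. lra.
Qed.

Lemma Cmod_INR n : Cmod (RtoC (INR n)) = INR n.
Proof. rewrite Cmod_R. apply Rabs_pos_eq, pos_INR. Qed.

Lemma im_le_Cmod (z : C) : (Rabs (Im z) <= Cmod z)%R.
Proof. eapply Rle_trans. 2: apply Rmax_Cmod. apply Rmax_r. Qed.

(** * Finite sums, limits and series of complex numbers *)

(** Unlike [sum_n], which has at least one term, these sums of the first [n]
    terms may be empty, so that [N] roots of unity go with [N] coefficients;
    and written with the operations of [C] they are accessible to [ring]. *)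
Fixpoint csum (u : nat -> C) (n : nat) : C :=
  match n with O => 0 | S m => csum u m + u m end.

Fixpoint rsum (u : nat -> R) (n : nat) : R :=
  match n with O => 0%R | S m => (rsum u m + u m)%R end.

Lemma csum_ext (u v : nat -> C) n : (forall k, (k < n)%nat -> u k = v k) -> csum u n = csum v n.
Proof.
induction n as [|n IH]; intros H; simpl. reflexivity.
rewrite IH, H. reflexivity. lia. intros k Hk. apply H. lia.
Qed.

Lemma csum_plus u v n : csum (fun k => u k + v k) n = csum u n + csum v n.
Proof. induction n as [|n IH]; simpl. ring. rewrite IH. ring. Qed.

Lemma csum_scal c u n : csum (fun k => c * u k) n = c * csum u n.
Proof. induction n as [|n IH]; simpl. ring. rewrite IH. ring. Qed.

Lemma csum_zero n : csum (fun _ => 0) n = 0.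
Proof. induction n as [|n IH]; simpl. ring. rewrite IH. ring. Qed.

Lemma csum_single (u : nat -> C) k n :
  (k < n)%nat -> (forall j, (j < n)%nat -> j <> k -> u j = 0) -> csum u n = u k.
Proof.
induction n as [|n IH]; intros Hk H. lia. simpl.
destruct (Nat.eq_dec k n) as [->|Hne].
- rewrite (csum_ext u (fun _ => 0)).
  rewrite csum_zero. ring. intros j Hj. apply H; lia.
- rewrite IH by (try lia; intros; apply H; lia). rewrite (H n) by lia. ring.
Qed.

Lemma csum_swap (u : nat -> nat -> C) n m :
  csum (fun i => csum (fun j => u i j) m) n = csum (fun j => csum (fun i => u i j) n) m.
Proof.
induction n as [|n IH]; simpl. symmetry. apply csum_zero.
rewrite IH, csum_plus. reflexivity.
Qed.

Lemma csum_shift u n : csum u (S n) = u O + csum (fun k => u (S k)) n.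
Proof.
induction n as [|n IH]. simpl. ring.
change (csum u (S (S n))) with (csum u (S n) + u (S n)). rewrite IH. simpl. ring.
Qed.

Lemma Cmod_csum u n : (Cmod (csum u n) <= rsum (fun k => Cmod (u k)) n)%R.
Proof.
induction n as [|n IH]; simpl. rewrite Cmod_0. lra.
eapply Rle_trans. apply Cmod_triangle. lra.
Qed.

Lemma rsum_le u v n : (forall k, (k < n)%nat -> (u k <= v k)%R) -> (rsum u n <= rsum v n)%R.
Proof.
induction n as [|n IH]; intros H; simpl. lra.
apply Rplus_le_compat. apply IH. intros; apply H; lia. apply H; lia.
Qed.

Lemma rsum_scal c u n : rsum (fun k => c * u k)%R n = (c * rsum u n)%R.
Proof. induction n as [|n IH]; simpl. ring. rewrite IH. ring. Qed.

Lemma rsum_const c n : rsum (fun _ => c) n = (INR n * c)%R.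
Proof. induction n as [|n IH]. simpl. ring. simpl rsum. rewrite IH, S_INR. ring. Qed.

Lemma rsum_sum_n u n : rsum u (S n) = sum_n u n.
Proof.
induction n as [|n IH]. simpl. rewrite sum_O. ring.
rewrite sum_Sn, <- IH. reflexivity.
Qed.

Lemma rsum_le_Series u : (forall k, (0 <= u k)%R) -> ex_series u ->
  forall n, (rsum u n <= Series u)%R.
Proof.
intros Hu Hex n.
assert (Hmono : forall m k, (rsum u m <= rsum u (m + k))%R).
{ intros m k. induction k as [|k IH]. rewrite Nat.add_0_r; lra.
  rewrite Nat.add_succ_r. simpl. specialize (Hu (m + k)%nat). lra. }
pose proof (Series_correct _ Hex) as Hs.
apply (is_lim_seq_le_loc (fun _ => rsum u n) (sum_n u) (rsum u n) (Series u)).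
- exists n. intros m Hm. rewrite <- rsum_sum_n.
  replace (S m) with (n + (S m - n))%nat by lia. apply Hmono.
- apply is_lim_seq_const.
- exact Hs.
Qed.

Definition climit (s : nat -> C) (l : C) : Prop :=
  forall eps : R, (0 < eps)%R ->
    exists N, forall n, (N <= n)%nat -> (Cmod (s n - l) < eps)%R.

Lemma climit_plus s t a b : climit s a -> climit t b -> climit (fun n => s n + t n) (a + b).
Proof.
intros Hs Ht eps He.
destruct (Hs (eps / 2)%R) as (N & HN). lra.
destruct (Ht (eps / 2)%R) as (M & HM). lra.
exists (max N M). intros n Hn.
replace (s n + t n - (a + b)) with ((s n - a) + (t n - b)) by ring.
eapply Rle_lt_trans. apply Cmod_triangle.
specialize (HN n ltac:(lia)). specialize (HM n ltac:(lia)). lra.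
Qed.

Lemma climit_scal c s a : climit s a -> climit (fun n => c * s n) (c * a).
Proof.
intros Hs eps He.
assert (Hc := Cmod_ge_0 c).
destruct (Hs (eps / (Cmod c + 1))%R) as (N & HN).
{ apply Rdiv_lt_0_compat; lra. }
exists N. intros n Hn. specialize (HN n Hn).
replace (c * s n - c * a) with (c * (s n - a)) by ring.
rewrite Cmod_mult.
apply Rle_lt_trans with (Cmod c * (eps / (Cmod c + 1)))%R.
- apply Rmult_le_compat_l; lra.
- apply Rlt_le_trans with ((Cmod c + 1) * (eps / (Cmod c + 1)))%R.
  + apply Rmult_lt_compat_r. apply Rdiv_lt_0_compat; lra. lra.
  + right. field. lra.
Qed.

Lemma climit_ext s t a : (forall n, s n = t n) -> climit s a -> climit t a.
Proof.
intros H Hs eps He. destruct (Hs eps He) as (N & HN). exists N.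
intros n Hn. rewrite <- H. auto.
Qed.

(** Power series are compared below at partial sums of different lengths; this
    lemma absorbs the offset. *)
Lemma climit_shift s a : climit s a <-> climit (fun n => s (S n)) a.
Proof.
split; intros Hs eps He; destruct (Hs eps He) as (N & HN).
- exists N. intros n Hn. apply HN. lia.
- exists (S N). intros [|n] Hn. lia. apply HN. lia.
Qed.

Lemma climit_S s a : climit s a -> climit (fun n => s (S n)) a.
Proof. apply climit_shift. Qed.

Lemma climit_bound s a K : climit s a -> (forall n, (Cmod (s n) <= K)%R) -> (Cmod a <= K)%R.
Proof.
intros Hs HK. apply Rnot_lt_le. intros Hlt.
destruct (Hs (Cmod a - K)%R) as (N & HN). lra.
specialize (HN N (le_n _)). specialize (HK N).
rewrite Cmod_sub_sym in HN.
pose proof (Cmod_triangle_rev a (s N)). lra.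
Qed.

Lemma climit_unique s a b : climit s a -> climit s b -> a = b.
Proof.
intros Ha Hb.
assert (H : (Cmod (a + (-1) * b) <= 0)%R).
{ apply (climit_bound (fun n => s n + (-1) * s n)).
  - apply climit_plus. exact Ha. apply climit_scal, Hb.
  - intros n. replace (s n + -1 * s n) with (RtoC 0) by ring. rewrite Cmod_0. lra. }
assert (H0 : a + (-1) * b = 0).
{ apply Cmod_eq_0. pose proof (Cmod_ge_0 (a + (-1) * b)). lra. }
replace a with ((a + (-1) * b) + b) by ring. rewrite H0. ring.
Qed.

(** The link with the notion of power series in the definition of
    [analytic_on].  The partial sums there have [n + 1] terms, those of [csum]
    have [n]. *)
Lemma is_pseries_climit a (z l : C) :
  @is_pseries C_AbsRing C_NormedModule a z l <-> climit (csum (fun k => a k * z ^ k)) l.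
Proof.
assert (Hs : forall n, sum_n (fun k => scal (pow_n (K := C_Ring) z k) (a k)) n
                      = csum (fun k => a k * z ^ k) (S n)).
{ intros n.
  assert (Hp : forall k, scal (pow_n (K := C_Ring) z k) (a k) = a k * z ^ k).
  { intros k.
    assert (Hpow : pow_n (K := C_Ring) z k = z ^ k).
    { induction k as [|k IH]. reflexivity. simpl. rewrite IH. reflexivity. }
    rewrite Hpow. exact (Cmult_comm (z ^ k) (a k)). }
  induction n as [|n IH].
  - rewrite sum_O, Hp. simpl. ring.
  - rewrite sum_Sn, Hp, IH. reflexivity. }
rewrite climit_shift.
unfold is_pseries, is_series.
rewrite (filterlim_locally_ball_norm (K := C_AbsRing) (U := C_NormedModule)).
split.
- intros H eps He. destruct (H (mkposreal eps He)) as (N & HN).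
  exists N. intros n Hn. rewrite <- Hs. exact (HN n Hn).
- intros H eps. destruct (H eps (cond_pos eps)) as (N & HN).
  exists N. intros n Hn. specialize (HN n Hn). rewrite <- Hs in HN. exact HN.
Qed.

Lemma climit_of_re_im (s : nat -> C) (x y : R) :
  is_lim_seq (fun n => Re (s n)) x -> is_lim_seq (fun n => Im (s n)) y ->
  climit s (x, y).
Proof.
intros Hx Hy eps He.
apply is_lim_seq_spec in Hx. apply is_lim_seq_spec in Hy.
assert (He2 : (0 < eps / 2)%R) by lra.
destruct (Hx (mkposreal _ He2)) as (N & HN). destruct (Hy (mkposreal _ He2)) as (M & HM).
exists (max N M). intros n Hn.
specialize (HN n ltac:(lia)). specialize (HM n ltac:(lia)). simpl in HN, HM.
replace (s n - (x, y)) with (RtoC (Re (s n) - x) + Ci * RtoC (Im (s n) - y)).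
- eapply Rle_lt_trans. apply Cmod_triangle.
  rewrite Cmod_mult, Cmod_Ci, !Cmod_R. lra.
- destruct (s n) as [a b]. unfold RtoC, Ci, Cminus, Cplus, Copp, Cmult. simpl. f_equal; ring.
Qed.

Lemma climit_of_abs_convergent u : ex_series (fun n => Cmod (u n)) -> exists l, climit (csum u) l.
Proof.
intros H.
assert (Hre : ex_series (fun n => Re (u n))).
{ apply (ex_series_le (K := R_AbsRing) (V := R_CompleteNormedModule) _ (fun n => Cmod (u n))).
  intros n. apply re_le_Cmod. exact H. }
assert (Him : ex_series (fun n => Im (u n))).
{ apply (ex_series_le (K := R_AbsRing) (V := R_CompleteNormedModule) _ (fun n => Cmod (u n))).
  intros n. eapply Rle_trans. 2: apply Rmax_Cmod. apply Rmax_r. exact H. }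
destruct Hre as (x & Hx). destruct Him as (y & Hy).
exists (x, y).
assert (Hr : forall n, Re (csum u n) = rsum (fun k => Re (u k)) n).
{ induction n as [|n IH]. reflexivity. simpl. rewrite <- IH. reflexivity. }
assert (Hi : forall n, Im (csum u n) = rsum (fun k => Im (u k)) n).
{ induction n as [|n IH]. reflexivity. simpl. rewrite <- IH. reflexivity. }
rewrite climit_shift.
apply climit_of_re_im.
- apply (is_lim_seq_ext (sum_n (fun k => Re (u k)))). 2: exact Hx.
  intros n. rewrite Hr, rsum_sum_n. reflexivity.
- apply (is_lim_seq_ext (sum_n (fun k => Im (u k)))). 2: exact Hy.
  intros n. rewrite Hi, rsum_sum_n. reflexivity.
Qed.

(** * Complex derivatives *)

(** Complex differentiability with the module structure fixed.  The one fixed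
    here is that of [C_derive]; product and chain rules are stated for the
    structure of the ring over itself, whose filters are built from another
    family of balls ([cder_iff_ring_module]). *)
Definition cder (f : C -> C) (z l : C) : Prop := @is_derive C_AbsRing C_NormedModule f z l.

Lemma cder_iff f z l : cder f z l <->
  forall eps : posreal, exists d : posreal, forall y, (Cmod (y - z) < d)%R ->
   (Cmod (f y - f z - (y - z) * l) <= eps * Cmod (y - z))%R.
Proof.
split.
- intros [_ H] eps. 
  destruct (H z (fun P HP => HP) eps) as (d & Hd).
  exists d. intros y Hy. exact (Hd y Hy).
- intros H. split. apply is_linear_scal_l.
  intros x Hx eps. 
  assert (Hxz : z = x) by exact (is_filter_lim_locally_unique (V := AbsRing_NormedModule C_AbsRing) z x Hx). subst x.
  destruct (H eps) as (d & Hd). exists d. intros y Hy. exact (Hd y Hy).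
Qed.

Lemma cder_iff_ring_module f z l : cder f z l <-> @is_derive C_AbsRing (AbsRing_NormedModule C_AbsRing) f z l.
Proof.
split; intros [H1 H]; (split; [apply is_linear_scal_l | exact H]).
Qed.

Lemma cder_mult f g z a b : cder f z a -> cder g z b -> cder (fun t => f t * g t) z (a * g z + f z * b).
Proof.
rewrite 3 cder_iff_ring_module. intros Hf Hg.
exact (@is_derive_mult C_AbsRing f g z a b Hf Hg Cmult_comm).
Qed.

Lemma cder_plus f g z a b : cder f z a -> cder g z b -> cder (fun t => f t + g t) z (a + b).
Proof. exact (@is_derive_plus C_AbsRing C_NormedModule f g z a b). Qed.

Lemma cder_comp f g z a b : cder f (g z) a -> cder g z b -> cder (fun t => f (g t)) z (b * a).
Proof. rewrite (cder_iff_ring_module g). exact (@is_derive_comp C_AbsRing C_NormedModule f g z a b). Qed.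

Lemma cder_const c z : cder (fun _ => c) z 0.
Proof. exact (@is_derive_const C_AbsRing C_NormedModule c z). Qed.

Lemma cder_id z : cder (fun t => t) z 1.
Proof. rewrite cder_iff_ring_module. exact (@is_derive_id C_AbsRing z). Qed.

Lemma cder_ext f g z l :
  (exists d : posreal, forall y, (Cmod (y - z) < d)%R -> f y = g y) -> cder f z l -> cder g z l.
Proof.
intros (d & Hd).
apply (@is_derive_ext_loc C_AbsRing C_NormedModule f g z l).
exists d. intros y Hy. apply Hd. exact Hy.
Qed.

Lemma cder_unique f z l : cder f z l -> C_derive f z = l.
Proof. exact (is_C_derive_unique f z l). Qed.

Lemma cder_eq f z l l' : cder f z l -> l = l' -> cder f z l'.
Proof. intros H <-. exact H. Qed.

(** The form in which derivatives are established directly: a quadratic error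
    term is easier to estimate than a little-o. *)
Lemma cder_quadratic f z l K d : (0 < d)%R ->
  (forall y, (Cmod (y - z) < d)%R -> (Cmod (f y - f z - (y - z) * l) <= K * (Cmod (y - z))^2)%R) ->
  cder f z l.
Proof.
intros Hd H. apply cder_iff. intros eps.
assert (HK : (0 < Rabs K + 1)%R) by (pose proof (Rabs_pos K); lra).
assert (Hd' : (0 < Rmin d (eps / (Rabs K + 1)))%R).
{ apply Rmin_pos. lra. apply Rdiv_lt_0_compat. apply eps. lra. }
exists (mkposreal _ Hd'). simpl. intros y Hy.
eapply Rle_trans. apply H. eapply Rlt_le_trans. apply Hy. apply Rmin_l.
pose proof (Rmin_r d (eps / (Rabs K + 1))).
pose proof (Cmod_ge_0 (y - z)). 
replace (K * Cmod (y - z) ^ 2)%R with ((K * Cmod (y - z)) * Cmod (y - z))%R by ring.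
apply Rmult_le_compat_r. lra.
apply Rle_trans with ((Rabs K + 1) * Cmod (y - z))%R.
apply Rmult_le_compat_r. lra. pose proof (Rle_abs K). lra.
apply Rle_trans with ((Rabs K + 1) * (eps / (Rabs K + 1)))%R.
apply Rmult_le_compat_l; lra. right. field. lra.
Qed.

(** * Termwise differentiation of power series *)

Definition coef_derive (a : nat -> C) (n : nat) : C := RtoC (INR (S n)) * a (S n).

(** Second-order Taylor bound for powers, by induction from
    [E (n+1) = y * E n + n z^(n-1) (y - z)^2], where [E n] is the quantity
    estimated for the exponent [n]. *)
Lemma pow_second_order (y z : C) (rho : R) k : (Cmod y <= rho)%R -> (Cmod z <= rho)%R ->
  (Cmod (y ^ (S (S k)) - z ^ (S (S k)) - (y - z) * (RtoC (INR (S (S k))) * z ^ (S k)))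
    <= INR (S k) * INR (S (S k)) * rho ^ k * Cmod (y - z) ^ 2)%R.
Proof.
intros Hy Hz.
assert (Hr : (0 <= rho)%R) by (pose proof (Cmod_ge_0 y); lra).
assert (Hh := Cmod_ge_0 (y - z)).
induction k as [|k IH].
- replace (y ^ 2 - z ^ 2 - (y - z) * (RtoC (INR 2) * z ^ 1)) with ((y - z) * (y - z)).
  rewrite Cmod_mult. simpl. nra.
  simpl INR. rewrite RtoC_plus. ring.
- set (n := S (S k)) in *.
  replace (y ^ S n - z ^ S n - (y - z) * (RtoC (INR (S n)) * z ^ n)) with
    (y * (y ^ n - z ^ n - (y - z) * (RtoC (INR n) * z ^ (S k)))
     + (y - z) * (y - z) * (RtoC (INR n) * z ^ (S k))).
  2:{ rewrite (S_INR n), RtoC_plus, !(Cpow_S _ n). unfold n at 6 8. rewrite (Cpow_S z (S k)). 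
      replace (z ^ n) with (z * z ^ (S k)) by reflexivity. ring. }
  eapply Rle_trans. apply Cmod_triangle. rewrite !Cmod_mult, Cmod_INR, Cmod_pow.
  assert (Hp : (0 <= rho ^ k)%R) by (apply pow_le; lra).
  assert (Hzp : (Cmod z ^ S k <= rho ^ S k)%R) by (apply pow_incr; split; [apply Cmod_ge_0 | lra]).
  assert (Hn : (0 <= INR n)%R) by apply pos_INR.
  apply Rle_trans with (rho * (INR (S k) * INR n * rho ^ k * Cmod (y - z) ^ 2)
      + Cmod (y - z) * Cmod (y - z) * (INR n * rho ^ S k))%R.
  + apply Rplus_le_compat.
    * apply Rmult_le_compat; try lra; apply Cmod_ge_0.
    * apply Rmult_le_compat_l. nra. apply Rmult_le_compat_l; lra.
  + assert (He : INR n = (INR (S k) + 1)%R) by (unfold n; apply S_INR).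
    rewrite (S_INR n). simpl pow.
    assert (0 <= INR (S k))%R by apply pos_INR.
    assert (0 <= rho * rho ^ k * (Cmod (y - z) * Cmod (y - z)) * INR n)%R.
    { apply Rmult_le_pos; [|lra]. apply Rmult_le_pos; [apply Rmult_le_pos; lra | nra]. }
    rewrite He in *. nra.
Qed.

(** Convergence at [rho2] bounds [|a_n| rho2^n], so the real series of the
    moduli has radius of convergence at least [rho2], and differentiating it
    does not change the radius. *)
Lemma pseries_abs_derivatives (a : nat -> C) (rho1 rho2 : R) l :
  (0 <= rho1 < rho2)%R -> climit (csum (fun k => a k * RtoC rho2 ^ k)) l ->
  ex_series (fun k => PS_derive (fun n => Cmod (a n)) k * rho1 ^ k)%R /\
  ex_series (fun k => PS_derive (PS_derive (fun n => Cmod (a n))) k * rho1 ^ k)%R.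
Proof.
intros Hr Hl.
assert (HB : exists B, forall n, (Rabs (Cmod (a n) * rho2 ^ n) <= B)%R).
{ assert (Hb : exists N, forall n, (N <= n)%nat -> (Cmod (a n) * rho2 ^ n <= 2)%R).
  { destruct (Hl 1%R ltac:(lra)) as (N & HN). exists N. intros n Hn.
    pose proof (HN n Hn) as H1. pose proof (HN (S n) ltac:(lia)) as H2.
    pose proof (Cmod_triangle_sub (csum (fun k => a k * RtoC rho2 ^ k) (S n) - l)
      (csum (fun k => a k * RtoC rho2 ^ k) n - l)) as H3. simpl csum in *.
    match type of H3 with (Cmod ?X <= _)%R =>
      replace X with (a n * RtoC rho2 ^ n) in H3 by ring end.
    rewrite Cmod_mult, Cmod_pow, Cmod_R, (Rabs_pos_eq rho2) in H3 by lra. lra. }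
  destruct Hb as (N & HN).
  exists (rsum (fun n => Cmod (a n) * rho2 ^ n) N + 2)%R.
  assert (Hpos : forall n, (0 <= Cmod (a n) * rho2 ^ n)%R).
  { intros n. apply Rmult_le_pos. apply Cmod_ge_0. apply pow_le. lra. }
  assert (Hsum : forall m, (0 <= rsum (fun n => Cmod (a n) * rho2 ^ n) m)%R /\
     forall n, (n < m)%nat -> (Cmod (a n) * rho2 ^ n <= rsum (fun n => Cmod (a n) * rho2 ^ n) m)%R).
  { induction m as [|m [IH1 IH2]]; simpl. split. lra. intros; lia.
    specialize (Hpos m) as Hm.
    split. lra. intros n Hn. destruct (Nat.eq_dec n m) as [->|Hne]. lra.
    specialize (IH2 n ltac:(lia)). lra. }
  intros n. rewrite Rabs_pos_eq by apply Hpos.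
  destruct (Nat.le_gt_cases N n) as [H|H].
  - specialize (HN n H). destruct (Hsum N). lra.
  - destruct (Hsum N) as [_ H2]. specialize (H2 n H). lra. }
assert (Hcv : Rbar_lt (Rabs rho1) (CV_radius (fun n => Cmod (a n)))).
{ eapply Rbar_lt_le_trans. 2: apply (proj1 (CV_radius_bounded _) rho2 HB).
  rewrite Rabs_pos_eq by lra. simpl. lra. }
split.
- apply (ex_pseries_R (PS_derive (fun n => Cmod (a n)))).
  apply CV_radius_inside. rewrite CV_radius_derive. exact Hcv.
- apply (ex_pseries_R (PS_derive (PS_derive (fun n => Cmod (a n))))).
  apply CV_radius_inside. rewrite !CV_radius_derive. exact Hcv.
Qed.

(** Termwise differentiation.  Summing [pow_second_order] against the
    coefficients bounds the error of the first-order expansion by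
    [|y - z|^2] times the second derivative of the series of moduli at
    [rho1]. *)
Lemma pseries_cder (a : nat -> C) (f : C -> C) (r : R) :
  (forall z, (Cmod z < r)%R -> climit (csum (fun k => a k * z ^ k)) (f z)) ->
  forall z, (Cmod z < r)%R ->
  exists l, cder f z l /\ climit (csum (fun k => coef_derive a k * z ^ k)) l.
Proof.
intros Hf z Hz.
assert (Hz0 := Cmod_ge_0 z).
set (rho1 := ((Cmod z + r) / 2)%R). set (rho2 := ((rho1 + r) / 2)%R).
assert (Hr : (Cmod z < rho1 < rho2 /\ rho2 < r)%R) by (unfold rho2, rho1; lra).
destruct (pseries_abs_derivatives a rho1 rho2 (f (RtoC rho2))) as (H1 & H2).
{ lra. }
{ apply Hf. rewrite Cmod_R, Rabs_pos_eq; lra. }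
destruct (climit_of_abs_convergent (fun k => coef_derive a k * z ^ k)) as (l & Hl).
{ eapply (ex_series_le (K := R_AbsRing) (V := R_CompleteNormedModule)). 2: exact H1.
  intros n. change (Rabs (Cmod (coef_derive a n * z ^ n)) <= PS_derive (fun n => Cmod (a n)) n * rho1 ^ n)%R.
  rewrite Rabs_pos_eq by apply Cmod_ge_0.
  unfold coef_derive, PS_derive. rewrite !Cmod_mult, Cmod_INR, Cmod_pow.
  apply Rmult_le_compat_l.
  - apply Rmult_le_pos. apply pos_INR. apply Cmod_ge_0.
  - apply pow_incr. lra. }
exists l. split; [|exact Hl].
set (c := fun k => (PS_derive (PS_derive (fun n => Cmod (a n))) k * rho1 ^ k)%R) in *.
apply (cder_quadratic f z l (Series c) (rho1 - Cmod z)). lra.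
intros y Hy.
assert (Hy1 : (Cmod y <= rho1)%R) by (pose proof (Cmod_triangle_rev y z); lra).
set (h := y - z) in *.
apply (climit_bound (fun n => csum (fun k => a k * y ^ k) (S (S n))
   + (-1) * csum (fun k => a k * z ^ k) (S (S n))
   + (- h) * csum (fun k => coef_derive a k * z ^ k) (S n))).
- replace (f y - f z - h * l) with (f y + (-1) * f z + (-h) * l) by ring.
  apply climit_plus. apply climit_plus.
  + apply (climit_S (fun n => csum _ (S n))), climit_S, Hf. lra.
  + apply climit_scal. apply (climit_S (fun n => csum _ (S n))), climit_S, Hf. lra.
  + apply climit_scal, climit_S, Hl.
- intros n.
  apply Rle_trans with (rsum c n * Cmod h ^ 2)%R.
  + induction n as [|n IH].
    * simpl. unfold coef_derive. simpl INR.
      match goal with |- (Cmod ?X <= _)%R => replace X with (RtoC 0) by (unfold h; ring) end.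
      rewrite Cmod_0. lra.
    * set (A := csum (fun k => a k * y ^ k)) in *. set (B := csum (fun k => a k * z ^ k)) in *.
      set (D := csum (fun k => coef_derive a k * z ^ k)) in *.
      change (A (S (S (S n)))) with (A (S (S n)) + a (S (S n)) * y ^ (S (S n))).
      change (B (S (S (S n)))) with (B (S (S n)) + a (S (S n)) * z ^ (S (S n))).
      change (D (S (S n))) with (D (S n) + coef_derive a (S n) * z ^ (S n)).
      change (rsum c (S n)) with (rsum c n + c n)%R.
      replace (A (S (S n)) + a (S (S n)) * y ^ S (S n) + -1 * (B (S (S n)) + a (S (S n)) * z ^ S (S n)) +
        - h * (D (S n) + coef_derive a (S n) * z ^ S n))
       with ((A (S (S n)) + -1 * B (S (S n)) + - h * D (S n))
        + a (S (S n)) * (y ^ (S (S n)) - z ^ (S (S n)) - h * (RtoC (INR (S (S n))) * z ^ S n)))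
       by (unfold coef_derive; ring).
      eapply Rle_trans. apply Cmod_triangle.
      rewrite Rmult_plus_distr_r. apply Rplus_le_compat. exact IH.
      rewrite Cmod_mult.
      pose proof (pow_second_order y z rho1 n Hy1 ltac:(lra)) as Hp. fold h in Hp.
      unfold c, PS_derive.
      apply Rle_trans with (Cmod (a (S (S n))) * (INR (S n) * INR (S (S n)) * rho1 ^ n * Cmod h ^ 2))%R.
      apply Rmult_le_compat_l. apply Cmod_ge_0. exact Hp.
      right. ring.
  + apply Rmult_le_compat_r. apply pow_le, Cmod_ge_0.
    apply rsum_le_Series; [|exact H2].
    intros k. unfold c, PS_derive.
    apply Rmult_le_pos. 2: apply pow_le; lra.
    apply Rmult_le_pos. apply pos_INR.
    apply Rmult_le_pos. apply pos_INR. apply Cmod_ge_0.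
Qed.

(** * Iterated complex differentiability *)

Definition copen (U : C -> Prop) : Prop :=
  forall z, U z -> exists d : posreal, forall y, (Cmod (y - z) < d)%R -> U y.

(** [C_derive] is a total function, so derivatives of every order can be
    named without carrying existence proofs; nothing is required at order 0. *)
Fixpoint Ck (n : nat) (U : C -> Prop) (f : C -> C) : Prop :=
  match n with
  | O => True
  | S m => (forall z, U z -> cder f z (C_derive f z)) /\ Ck m U (C_derive f)
  end.

Lemma cder_ext_on U f g z l : copen U -> U z -> (forall y, U y -> f y = g y) ->
  cder f z l -> cder g z l.
Proof.
intros HU Hz Hfg. apply cder_ext. destruct (HU z Hz) as (d & Hd).
exists d. intros y Hy. apply Hfg, Hd, Hy.
Qed.

Lemma Ck_ext n : forall U f g, copen U -> (forall z, U z -> f z = g z) -> Ck n U f -> Ck n U g.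
Proof.
induction n as [|n IH]; intros U f g HU Hfg; simpl. trivial.
intros (Hd & Hn).
assert (Hg : forall z, U z -> cder g z (C_derive f z)).
{ intros z Hz. apply (cder_ext_on U f g z _ HU Hz Hfg). apply Hd, Hz. }
assert (He : forall z, U z -> C_derive f z = C_derive g z).
{ intros z Hz. symmetry. apply cder_unique, Hg, Hz. }
split.
- intros z Hz. rewrite <- He by exact Hz. apply Hg, Hz.
- apply (IH U (C_derive f)); assumption.
Qed.

(** The way to climb one order: any formula for the derivative on the open set
    will do, because the value of [C_derive] is then determined there. *)
Lemma Ck_intro n U f g : copen U -> (forall z, U z -> cder f z (g z)) -> Ck n U g -> Ck (S n) U f.
Proof.
intros HU Hd Hg.
assert (He : forall z, U z -> g z = C_derive f z).
{ intros z Hz. symmetry. apply cder_unique, Hd, Hz. }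
split.
- intros z Hz. rewrite <- He by exact Hz. apply Hd, Hz.
- apply (Ck_ext n U g); assumption.
Qed.

Lemma Ck_pred n : forall U f, Ck (S n) U f -> Ck n U f.
Proof.
induction n as [|n IH]; intros U f H. exact I.
destruct H as (H1 & H2). split. exact H1. apply IH, H2.
Qed.

Lemma Ck_subset n : forall (U V : C -> Prop) f, (forall z, V z -> U z) -> Ck n U f -> Ck n V f.
Proof.
induction n as [|n IH]; intros U V f HV H. exact I.
destruct H as (H1 & H2). split. intros z Hz. apply H1, HV, Hz. apply (IH U); assumption.
Qed.

Lemma Ck_const n : forall U c, copen U -> Ck n U (fun _ => c).
Proof.
induction n as [|n IH]; intros U c HU. exact I.
apply (Ck_intro n U _ (fun _ => 0)). exact HU. intros; apply cder_const. apply IH, HU.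
Qed.

Lemma Ck_id n U : copen U -> Ck n U (fun z => z).
Proof.
intros HU. destruct n as [|n]. exact I.
apply (Ck_intro n U _ (fun _ => 1)). exact HU. intros; apply cder_id. apply Ck_const, HU.
Qed.

Lemma Ck_plus n : forall U f g, copen U -> Ck n U f -> Ck n U g -> Ck n U (fun z => f z + g z).
Proof.
induction n as [|n IH]; intros U f g HU Hf Hg. exact I.
destruct Hf as (Hf1 & Hf2). destruct Hg as (Hg1 & Hg2).
apply (Ck_intro n U _ (fun z => C_derive f z + C_derive g z)). exact HU.
- intros z Hz. apply cder_plus; auto.
- apply IH; assumption.
Qed.

Lemma Ck_mult n : forall U f g, copen U -> Ck n U f -> Ck n U g -> Ck n U (fun z => f z * g z).
Proof.
induction n as [|n IH]; intros U f g HU Hf Hg. exact I.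
pose proof (Ck_pred n U f Hf) as Hf0. pose proof (Ck_pred n U g Hg) as Hg0.
destruct Hf as (Hf1 & Hf2). destruct Hg as (Hg1 & Hg2).
apply (Ck_intro n U _ (fun z => C_derive f z * g z + f z * C_derive g z)). exact HU.
- intros z Hz. apply cder_mult; auto.
- apply Ck_plus. exact HU. apply IH; assumption. apply IH; assumption.
Qed.

Lemma Ck_minus n U f g : copen U -> Ck n U f -> Ck n U g -> Ck n U (fun z => f z - g z).
Proof.
intros HU Hf Hg. apply (Ck_ext n U (fun z => f z + (-1) * g z)). exact HU. intros; ring.
apply Ck_plus; try assumption. apply Ck_mult; try assumption. apply Ck_const, HU.
Qed.

Lemma Ck_pow n U f k : copen U -> Ck n U f -> Ck n U (fun z => f z ^ k).
Proof.
intros HU Hf. induction k as [|k IH]; simpl. apply Ck_const, HU. apply Ck_mult; assumption.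
Qed.

Lemma Ck_csum n U (F : nat -> C -> C) m : copen U -> (forall k, Ck n U (F k)) ->
  Ck n U (fun z => csum (fun k => F k z) m).
Proof.
intros HU HF. induction m as [|m IH]; simpl. apply Ck_const, HU. apply Ck_plus; auto.
Qed.

Lemma cder_continuous f z l : cder f z l -> forall eps : R, (0 < eps)%R ->
  exists d : posreal, forall y, (Cmod (y - z) < d)%R -> (Cmod (f y - f z) < eps)%R.
Proof.
intros H eps He. apply cder_iff with (eps := mkposreal 1 Rlt_0_1) in H.
destruct H as (d & Hd). simpl in Hd.
assert (Hl := Cmod_ge_0 l).
assert (Hp : (0 < Rmin d (eps / (Cmod l + 2)))%R).
{ apply Rmin_pos. apply d. apply Rdiv_lt_0_compat; lra. }
exists (mkposreal _ Hp). simpl. intros y Hy.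
assert (Hy1 : (Cmod (y - z) < d)%R) by (eapply Rlt_le_trans; [exact Hy | apply Rmin_l]).
assert (Hy2 : (Cmod (y - z) < eps / (Cmod l + 2))%R) by (eapply Rlt_le_trans; [exact Hy | apply Rmin_r]).
specialize (Hd y Hy1).
pose proof (Cmod_triangle (f y - f z - (y - z) * l) ((y - z) * l)) as Ht.
replace (f y - f z - (y - z) * l + (y - z) * l) with (f y - f z) in Ht by ring.
rewrite Cmod_mult in Ht. pose proof (Cmod_ge_0 (y - z)).
assert (Cmod (y - z) * (Cmod l + 2) < eps)%R.
{ apply Rmult_lt_compat_r with (r := (Cmod l + 2)%R) in Hy2. 2: lra.
  replace (eps / (Cmod l + 2) * (Cmod l + 2))%R with eps in Hy2 by (field; lra). exact Hy2. }
nra.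
Qed.

Lemma cder_inv_id (z : C) : z <> 0 -> cder Cinv z (- (/ z * / z)).
Proof.
intros Hz.
assert (Hz0 : (0 < Cmod z)%R) by (apply Cmod_gt_0, Hz).
apply (cder_quadratic _ z _ (2 / (Cmod z ^ 3)) (Cmod z / 2)). lra.
intros y Hy.
assert (Hyz : (Cmod z / 2 <= Cmod y)%R).
{ pose proof (Cmod_triangle_rev z y). rewrite Cmod_sub_sym in Hy. lra. }
assert (Hy0 : y <> 0).
{ intros ->. rewrite Cmod_0 in Hyz. lra. }
replace (/ y - / z - (y - z) * - (/ z * / z)) with ((y - z) * (y - z) * (/ y * (/ z * / z))).
2: field; split; assumption.
rewrite !Cmod_mult, !Cmod_inv by assumption.
assert (Hi : (/ Cmod y <= 2 / Cmod z)%R).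
{ replace (2 / Cmod z)%R with (/ (Cmod z / 2))%R by (field; lra). apply Rinv_le_contravar; lra. }
assert (Hi0 : (0 < / Cmod z)%R) by (apply Rinv_0_lt_compat, Hz0).
pose proof (Cmod_ge_0 (y - z)).
apply Rle_trans with (Cmod (y - z) * Cmod (y - z) * (2 / Cmod z * (/ Cmod z * / Cmod z)))%R.
- apply Rmult_le_compat_l. nra. apply Rmult_le_compat_r. nra. exact Hi.
- right. field. lra.
Qed.

Lemma Ck_inv n : forall U (f : C -> C), copen U -> (forall z, U z -> f z <> 0) -> Ck n U f -> Ck n U (fun z => / f z).
Proof.
induction n as [|n IH]; intros U f HU Hnz Hf. exact I.
pose proof (Ck_pred n U f Hf) as Hf0.
destruct Hf as (Hf1 & Hf2).
apply (Ck_intro n U _ (fun z => C_derive f z * ((-1) * (/ f z * / f z)))). exact HU.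
- intros z Hz. apply cder_eq with (C_derive f z * - (/ f z * / f z)). 2: ring.
  apply (cder_comp Cinv f). apply cder_inv_id. apply Hnz, Hz. apply Hf1, Hz.
- apply Ck_mult; try assumption. apply Ck_mult. assumption. apply Ck_const, HU.
  apply Ck_mult; auto.
Qed.

Lemma Ck_affine n : forall (U : C -> Prop) f (c b : C), copen U ->
  Ck n U f -> copen (fun z => U (c * z + b)) ->
  Ck n (fun z => U (c * z + b)) (fun z => f (c * z + b)).
Proof.
induction n as [|n IH]; intros U f c b HU Hf HV. exact I.
destruct Hf as (Hf1 & Hf2).
apply (Ck_intro n _ _ (fun z => c * C_derive f (c * z + b))). exact HV.
- intros z Hz. apply (cder_comp f (fun z => c * z + b)). apply Hf1, Hz.
  apply cder_eq with ((0 * z + c * 1) + 0). 2: ring.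
  apply cder_plus. apply (cder_mult (fun _ => c) (fun z => z)). apply cder_const. apply cder_id. apply cder_const.
- apply Ck_mult. exact HV. apply Ck_const, HV. apply (IH U (C_derive f)); assumption.
Qed.

Lemma copen_affine (U : C -> Prop) c b : copen U -> copen (fun z => U (c * z + b)).
Proof.
intros HU z Hz. destruct (HU _ Hz) as (d & Hd).
assert (Hc := Cmod_ge_0 c).
assert (Hp : (0 < d / (Cmod c + 1))%R) by (apply Rdiv_lt_0_compat; [apply d | lra]).
exists (mkposreal _ Hp). simpl. intros y Hy. apply Hd.
replace (c * y + b - (c * z + b)) with (c * (y - z)) by ring.
rewrite Cmod_mult.
pose proof (Cmod_ge_0 (y - z)).
apply Rmult_lt_compat_r with (r := (Cmod c + 1)%R) in Hy. 2: lra.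
replace (d / (Cmod c + 1) * (Cmod c + 1))%R with (pos d) in Hy by (field; lra). nra.
Qed.

Lemma copen_ball r : copen (fun z => (Cmod z < r)%R).
Proof.
intros z Hz. assert (Hp : (0 < r - Cmod z)%R) by lra.
exists (mkposreal _ Hp). simpl. intros y Hy. pose proof (Cmod_triangle_rev y z). lra.
Qed.

Lemma copen_nonzero : copen (fun z => z <> 0).
Proof.
intros z Hz. assert (Hp : (0 < Cmod z)%R) by (apply Cmod_gt_0, Hz).
exists (mkposreal _ Hp). simpl. intros y Hy ->.
rewrite Cmod_sub_sym in Hy. replace (z - 0) with z in Hy by ring. lra.
Qed.

Lemma copen_and U V : copen U -> copen V -> copen (fun z => U z /\ V z).
Proof.
intros HU HV z (Hz1 & Hz2). destruct (HU z Hz1) as (d1 & H1). destruct (HV z Hz2) as (d2 & H2).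
assert (Hp : (0 < Rmin d1 d2)%R) by (apply Rmin_pos; [apply d1 | apply d2]).
exists (mkposreal _ Hp). simpl. intros y Hy. split.
- apply H1. eapply Rlt_le_trans. exact Hy. apply Rmin_l.
- apply H2. eapply Rlt_le_trans. exact Hy. apply Rmin_r.
Qed.

(** The derivative of a function that is locally a power series is given, on
    the same balls, by the differentiated series. *)
Lemma analytic_on_cder U f : analytic_on U f ->
  (forall z, U z -> cder f z (C_derive f z)) /\ analytic_on U (C_derive f).
Proof.
intros Hf.
assert (Hloc : forall z0, U z0 -> exists a (r : posreal), forall z, (Cmod (z - z0) < r)%R ->
   exists l, cder f z l /\ climit (csum (fun k => a k * (z - z0) ^ k)) l).
{ intros z0 Hz0. destruct (Hf z0 Hz0) as (a & r & Ha).
  exists (coef_derive a), r. intros z Hz.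
  destruct (pseries_cder a (fun h => f (h + z0)) r) with (z := z - z0) as (l & Hl1 & Hl2).
  - intros h Hh. specialize (Ha (h + z0)). replace (h + z0 - z0) with h in Ha by ring.
    apply is_pseries_climit. apply Ha, Hh.
  - exact Hz.
  - exists l. split; [|exact Hl2].
    apply (cder_ext (fun t => f ((t - z0) + z0))).
    { exists (mkposreal 1 Rlt_0_1). intros y _. f_equal. ring. }
    apply cder_eq with ((1 + 0) * l). 2: ring.
    apply (cder_comp (fun h => f (h + z0)) (fun t => t - z0)). exact Hl1.
    apply (cder_plus (fun t => t) (fun _ => - z0)). apply cder_id. apply cder_const. }
split.
- intros z Hz. destruct (Hloc z Hz) as (a & r & H).
  destruct (H z) as (l & Hl & _).
  { replace (z - z) with (RtoC 0) by ring. rewrite Cmod_0. apply r. }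
  rewrite (cder_unique _ _ _ Hl). exact Hl.
- intros z0 Hz0. destruct (Hloc z0 Hz0) as (a & r & H). exists a, r.
  intros z Hz. destruct (H z Hz) as (l & Hl1 & Hl2).
  rewrite (cder_unique _ _ _ Hl1). apply is_pseries_climit. exact Hl2.
Qed.

Lemma analytic_Ck n : forall U f, analytic_on U f -> Ck n U f.
Proof.
induction n as [|n IH]; intros U f Hf. exact I.
destruct (analytic_on_cder U f Hf) as (H1 & H2). split. exact H1. apply IH, H2.
Qed.

(** * Maximum principle *)

(** Compactness of a square, in the form of Lebesgue's number: a property that
    gets weaker as [d] decreases and holds with some [d] near every point of
    the plane holds with a single [d] on any bounded set.  Points outside [U]
    must be covered too, since [U] need not be closed. *)
Lemma uniform_radius_on_bounded (U : C -> Prop) (r : R) (Phi : R -> C -> Prop) :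
  (forall z, U z -> (Cmod z <= r)%R) ->
  (forall d d' z, (0 < d' <= d)%R -> Phi d z -> Phi d' z) ->
  (forall P, exists d : posreal, forall z, U z -> (Cmod (z - P) < d)%R -> Phi d z) ->
  exists d : posreal, forall z, U z -> Phi d z.
Proof.
intros HU Hanti Hloc.
destruct (choice _ Hloc) as (delta & Hdelta).
destruct (compactness_value_2d (-r) r (-r) r (fun x y => pos_div_2 (delta (x, y)))) as (d & Hd).
exists d. intros z Hz.
specialize (HU z Hz).
assert (H1 := re_le_Cmod z). assert (H2 := im_le_Cmod z).
destruct z as [x y]. simpl in H1, H2.
assert (Hx : (- r <= x <= r)%R) by (apply Rabs_le_between; lra).
assert (Hy : (- r <= y <= r)%R) by (apply Rabs_le_between; lra).
apply NNPP. intros Hn. apply (Hd x y Hx Hy). intros (u & v & _ & _ & Hu & Hv & Hduv).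
apply Hn. simpl in *.
apply Hanti with (delta (u, v)).
{ split. apply d. pose proof (cond_pos (delta (u, v))). lra. }
apply Hdelta. exact Hz.
eapply Rle_lt_trans with (Rabs (x - u) + Rabs (y - v))%R. 2: lra.
replace ((x, y) - (u, v)) with (RtoC (x - u) + Ci * RtoC (y - v)).
- eapply Rle_trans. apply Cmod_triangle. rewrite Cmod_mult, Cmod_Ci, !Cmod_R. lra.
- unfold RtoC, Ci, Cminus, Cplus, Copp, Cmult. simpl. f_equal; ring.
Qed.

(** According to the sign of [du 0], move right or left: near 0 the derivative
    stays strictly of the sign that makes [u] increase away from 0, because its
    own derivative is positive. *)
Lemma second_derivative_test (u du : R -> R) (l d : R) : (0 < d)%R -> (0 < l)%R ->
  (forall t, (Rabs t < d)%R -> is_derive u t (du t)) -> is_derive du 0%R l ->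
  exists t, (Rabs t < d)%R /\ (u 0%R < u t)%R.
Proof.
intros Hd Hl Hu Hdu.
destruct Hdu as [_ Hdu].
assert (Hl2 : (0 < l / 2)%R) by lra.
destruct (Hdu 0%R (fun P HP => HP) (mkposreal _ Hl2)) as (e & He).
assert (He' : forall y, (Rabs y < e)%R -> (Rabs (du y - du 0 - y * l) <= l / 2 * Rabs y)%R).
{ intros y Hy. specialize (He y).
  assert (Hb : ball (0 : R_AbsRing) e (y : R_AbsRing)).
  { change (Rabs (y - 0) < e)%R. rewrite Rminus_0_r. exact Hy. }
  specialize (He Hb).
  change (Rabs (du y - du 0 - (y - 0) * l) <= l / 2 * Rabs (y - 0))%R in He.
  rewrite Rminus_0_r in He. exact He. }
set (m := (Rmin d e / 2)%R).
assert (Hm : (0 < m /\ m < d /\ m < e)%R).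
{ unfold m. pose proof (cond_pos e). pose proof (Rmin_l d e). pose proof (Rmin_r d e).
  assert (0 < Rmin d e)%R by (apply Rmin_pos; lra). lra. }
assert (Hlim : forall x, (- m <= x <= m)%R -> derivable_pt_lim u x (du x)).
{ intros x Hx. apply is_derive_Reals, Hu. apply Rle_lt_trans with m. apply Rabs_le; lra. lra. }
destruct (Rle_lt_dec 0 (du 0)) as [H0|H0].
- exists m. split. rewrite Rabs_pos_eq; lra.
  destruct (MVT_cor2 u du 0 m) as (c & Heq & Hc). lra. intros x Hx. apply Hlim. lra.
  specialize (He' c). rewrite (Rabs_pos_eq c) in He' by lra.
  specialize (He' ltac:(lra)). apply Rabs_le_between in He'.
  assert (0 < c * l)%R by nra. assert (0 < du c)%R by nra.
  assert (0 < du c * (m - 0))%R by (apply Rmult_lt_0_compat; lra). lra.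
- exists (- m)%R. split. rewrite Rabs_Ropp, Rabs_pos_eq; lra.
  destruct (MVT_cor2 u du (- m) 0) as (c & Heq & Hc). lra. intros x Hx. apply Hlim. lra.
  specialize (He' c). rewrite (Rabs_left c) in He' by lra.
  specialize (He' ltac:(lra)). apply Rabs_le_between in He'.
  assert (c * l < 0)%R by nra. assert (du c < 0)%R by nra.
  assert (0 < - du c * (0 - - m))%R by (apply Rmult_lt_0_compat; lra). lra.
Qed.

Lemma is_derive_line_re f z e t l : cder f (z + RtoC t * e) l ->
  is_derive (fun s : R => Re (f (z + RtoC s * e))) t (Re (e * l)).
Proof.
intros H. rewrite cder_iff in H.
split. apply is_linear_scal_l.
intros x Hx eps.
assert (Htx : t = x) by exact (is_filter_lim_locally_unique (V := R_NormedModule) t x Hx). subst x.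
assert (He := Cmod_ge_0 e).
assert (Heps : (0 < eps / (Cmod e + 1))%R) by (apply Rdiv_lt_0_compat; [apply eps | lra]).
destruct (H (mkposreal _ Heps)) as (d & Hd). simpl in Hd.
assert (Hd' : (0 < d / (Cmod e + 1))%R) by (apply Rdiv_lt_0_compat; [apply d | lra]).
exists (mkposreal _ Hd').
enough (Hmain : forall y : R, (Rabs (y - t) < d / (Cmod e + 1))%R ->
  (Rabs (Re (f (z + RtoC y * e)%C) - Re (f (z + RtoC t * e)%C) - (y - t) * Re (e * l))
   <= eps * Rabs (y - t))%R) by exact Hmain.
intros y Hy.
assert (Hh := Rabs_pos (y - t)).
assert (Hm : Cmod (z + RtoC y * e - (z + RtoC t * e)) = (Rabs (y - t) * Cmod e)%R).
{ rewrite <- Cmod_R, <- Cmod_mult. f_equal. rewrite RtoC_minus. ring. }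
assert (Hlt : (Rabs (y - t) * Cmod e < d)%R).
{ apply Rmult_lt_compat_r with (r := (Cmod e + 1)%R) in Hy. 2: lra.
  replace (d / (Cmod e + 1) * (Cmod e + 1))%R with (pos d) in Hy by (field; lra). nra. }
specialize (Hd (z + RtoC y * e)). rewrite Hm in Hd. specialize (Hd Hlt).
eapply Rle_trans. eapply Rle_trans. 2: apply re_le_Cmod. 2: eapply Rle_trans. 2: exact Hd.
- right. f_equal.
  replace (z + RtoC y * e - (z + RtoC t * e)) with (RtoC (y - t) * e) by (rewrite RtoC_minus; ring).
  destruct (f (z + RtoC y * e)%C), (f (z + RtoC t * e)%C), e, l. simpl. ring.
- apply Rle_trans with (eps / (Cmod e + 1) * (Rabs (y - t) * (Cmod e + 1)))%R.
  + apply Rmult_le_compat_l. lra. apply Rmult_le_compat_l; lra.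
  + right. field. lra.
Qed.

(** The imaginary part of [f] is the real part of [- i f]. *)
Lemma is_derive_line_im f z e t l : cder f (z + RtoC t * e) l ->
  is_derive (fun s : R => Im (f (z + RtoC s * e)%C)) t (Im (e * l)).
Proof.
intros H.
assert (Hr : forall w, Im w = Re (- Ci * w)).
{ intros [a b]. simpl. ring. }
apply (is_derive_ext (fun s : R => Re ((fun x => - Ci * f x) (z + RtoC s * e)))).
{ intros s. symmetry. apply Hr. }
rewrite Hr. replace (- Ci * (e * l)) with (e * (0 * f (z + RtoC t * e) + - Ci * l)) by ring.
apply (is_derive_line_re (fun x => - Ci * f x) z e t). apply (cder_mult (fun _ => - Ci)). apply cder_const. exact H.
Qed.

Lemma is_derive_Cmod2_line f z e t l : cder f (z + RtoC t * e) l ->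
  is_derive (fun s : R => (Cmod (f (z + RtoC s * e)%C) ^ 2)%R) t
    (2 * Re (Cconj (f (z + RtoC t * e)%C) * (e * l)))%R.
Proof.
intros H.
pose proof (is_derive_line_re _ _ _ _ _ H) as Hr. pose proof (is_derive_line_im _ _ _ _ _ H) as Hi.
set (A := fun s : R => Re (f (z + RtoC s * e)%C)) in *.
set (B := fun s : R => Im (f (z + RtoC s * e)%C)) in *.
apply (is_derive_ext (fun s => A s ^ 2 + B s ^ 2)%R).
{ intros s. symmetry. apply Cmod2_alt. }
replace (2 * Re (Cconj (f (z + RtoC t * e)%C) * (e * l)))%R with
  (INR 2 * Re (e * l) * A t ^ Nat.pred 2 + INR 2 * Im (e * l) * B t ^ Nat.pred 2)%R.
- apply @is_derive_plus; apply is_derive_pow; assumption.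
- unfold A, B. destruct (f (z + RtoC t * e)%C), (e * l). simpl. ring.
Qed.

(** The Laplacian of [|F|^2 + eps |z|^2] is [4 |F'|^2 + 4 eps > 0], so the
    second derivative is positive along some line through [z0].  It suffices to
    try the directions 1 and [i]: the term in the second derivative of [F]
    changes sign between them, the others are nonnegative. *)
Lemma Cmod2_no_local_max (U : C -> Prop) F z0 eps : copen U -> Ck 2 U F -> U z0 ->
  (0 < eps)%R ->
  exists z, U z /\ (Cmod (F z0) ^ 2 + eps * Cmod z0 ^ 2 < Cmod (F z) ^ 2 + eps * Cmod z ^ 2)%R.
Proof.
intros HU (H1 & H2 & _) Hz0 Heps.
set (F1 := C_derive F) in *. set (F2 := C_derive F1) in *.
assert (He : exists e, Cmod e = 1%R /\ (0 <= Re (Cconj (F z0) * (e * (e * F2 z0))))%R).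
{ destruct (Rle_lt_dec 0 (Re (Cconj (F z0) * F2 z0))) as [H|H].
  - exists 1. split. apply Cmod_1. replace (1 * (1 * F2 z0)) with (F2 z0) by ring. exact H.
  - exists Ci. split. apply Cmod_Ci.
    replace (Re (Cconj (F z0) * (Ci * (Ci * F2 z0)))) with (- Re (Cconj (F z0) * F2 z0))%R. lra.
    destruct (F z0), (F2 z0). simpl. ring. }
destruct He as (e & He1 & He2).
destruct (HU z0 Hz0) as (r & Hr).
assert (Hline : forall t, (Rabs t < r)%R -> U (z0 + RtoC t * e)).
{ intros t Ht. apply Hr. replace (z0 + RtoC t * e - z0) with (RtoC t * e) by ring.
  rewrite Cmod_mult, Cmod_R, He1. lra. }
assert (H00 : z0 + RtoC 0 * e = z0) by ring.
set (u := fun t : R => (Cmod (F (z0 + RtoC t * e)%C) ^ 2 + eps * Cmod (z0 + RtoC t * e) ^ 2)%R).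
set (du := fun t : R => (2 * Re (Cconj (F (z0 + RtoC t * e)%C) * (e * F1 (z0 + RtoC t * e)%C))
    + eps * (2 * Re (Cconj (z0 + RtoC t * e) * (e * 1))))%R).
destruct (second_derivative_test u du
   (2 * (Cmod (e * F1 z0) ^ 2 + Re (Cconj (F z0) * (e * (e * F2 z0)))) + eps * 2)%R r) as (t & Ht & Hlt).
- apply r.
- pose proof (pow2_ge_0 (Cmod (e * F1 z0))). lra.
- intros t Ht. unfold u, du.
  apply @is_derive_plus. apply is_derive_Cmod2_line. apply H1, Hline, Ht.
  apply is_derive_scal. apply (is_derive_Cmod2_line (fun w => w)). apply cder_id.
- pose proof (H1 _ Hz0) as D1. pose proof (H2 _ Hz0) as D2. fold F1 F2 in D1, D2.
  rewrite <- H00 in D1, D2.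
  pose proof (is_derive_line_re _ _ _ _ _ D1) as R1. pose proof (is_derive_line_im _ _ _ _ _ D1) as I1.
  pose proof (is_derive_line_re _ _ _ _ _ D2) as R2. pose proof (is_derive_line_im _ _ _ _ _ D2) as I2.
  set (p1 := fun t : R => Re (F (z0 + RtoC t * e)%C)) in *.
  set (p2 := fun t : R => Im (F (z0 + RtoC t * e)%C)) in *.
  set (q1 := fun t : R => Re (F1 (z0 + RtoC t * e)%C)) in *.
  set (q2 := fun t : R => Im (F1 (z0 + RtoC t * e)%C)) in *.
  set (w1 := fun t : R => Re (z0 + RtoC t * e)).
  set (w2 := fun t : R => Im (z0 + RtoC t * e)).
  assert (R3 : is_derive w1 0%R (Re (e * 1))) by (apply (is_derive_line_re (fun w => w)), cder_id).
  assert (I3 : is_derive w2 0%R (Im (e * 1))) by (apply (is_derive_line_im (fun w => w)), cder_id).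
  apply (is_derive_ext (fun t => 2 * (p1 t * (Re e * q1 t - Im e * q2 t) + p2 t * (Re e * q2 t + Im e * q1 t))
     + eps * (2 * (w1 t * Re e + w2 t * Im e)))%R).
  { intros t. unfold du, p1, p2, q1, q2, w1, w2.
    destruct (F (z0 + RtoC t * e)%C), (F1 (z0 + RtoC t * e)%C), (z0 + RtoC t * e), e. simpl. ring. }
  auto_derive.
  + repeat split; eexists; eassumption.
  + change (fun x : R => p1 x) with p1. change (fun x : R => p2 x) with p2.
    change (fun x : R => q1 x) with q1. change (fun x : R => q2 x) with q2.
    change (fun x : R => w1 x) with w1. change (fun x : R => w2 x) with w2.
    rewrite (is_derive_unique _ _ _ R1), (is_derive_unique _ _ _ I1), (is_derive_unique _ _ _ R2),
      (is_derive_unique _ _ _ I2), (is_derive_unique _ _ _ R3), (is_derive_unique _ _ _ I3).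
    unfold p1, p2, q1, q2. rewrite H00, Cmod2_alt.
    assert (He3 : (Re e ^ 2 + Im e ^ 2 = 1)%R) by (rewrite <- Cmod2_alt, He1; ring).
    destruct (F z0), (F1 z0), (F2 z0), e. simpl in *.
    nra.
- exists (z0 + RtoC t * e). split. apply Hline, Ht. unfold u in Hlt. rewrite H00 in Hlt. exact Hlt.
Qed.

Lemma square_slack (a b eps S : R) : (0 <= a)%R -> (0 <= b)%R -> (0 <= eps)%R ->
  (a ^ 2 + eps * b ^ 2 < S)%R ->
  exists eta, (0 < eta)%R /\ ((a + eta) ^ 2 + eps * (b + eta) ^ 2 < S - eta)%R.
Proof.
intros Ha Hb He HS.
set (g := (S - (a ^ 2 + eps * b ^ 2))%R).
set (k := (2 * a + 1 + eps * (2 * b + 1) + 2)%R).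
assert (Hg : (0 < g)%R) by (unfold g; lra).
assert (Hk : (2 < k)%R) by (unfold k; nra).
set (eta := Rmin 1 (g / k)).
assert (H1 : (eta <= 1)%R) by apply Rmin_l.
assert (H2 : (eta <= g / k)%R) by apply Rmin_r.
assert (H0 : (0 < eta)%R) by (apply Rmin_pos; [lra | apply Rdiv_lt_0_compat; lra]).
assert (H3 : (eta * k <= g)%R).
{ apply Rmult_le_compat_r with (r := k) in H2. 2: lra.
  replace (g / k * k)%R with g in H2 by (field; lra). exact H2. }
exists eta. split. exact H0.
assert (eta ^ 2 <= eta)%R by nra.
assert (eps * eta ^ 2 <= eps * eta)%R by (apply Rmult_le_compat_l; lra).
unfold g, k in H3. nra.
Qed.

Lemma Rsqr_sum_le a b eps x y : (0 <= x <= a)%R -> (0 <= y <= b)%R -> (0 <= eps)%R ->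
  (x ^ 2 + eps * y ^ 2 <= a ^ 2 + eps * b ^ 2)%R.
Proof.
intros Hx Hy He.
apply Rplus_le_compat. apply pow_incr; lra. apply Rmult_le_compat_l. lra. apply pow_incr; lra.
Qed.

(** If [|F|] exceeded [B] somewhere, then for a small [eps] the supremum [S] of
    [|F|^2 + eps |z|^2] would exceed its limiting values at the boundary, and by
    [Cmod2_no_local_max] it is not attained inside.  So near every point the
    function stays below [S] by a margin, and by compactness the margin is
    uniform, which contradicts the definition of [S].  The boundary condition is
    an upper limit because [F] may have no limit at a boundary point, such as
    an isolated singularity. *)
Theorem maximum_principle (U : C -> Prop) (F : C -> C) (r B : R) :
  copen U -> (forall z, U z -> (Cmod z <= r)%R) -> Ck 2 U F -> (0 <= B)%R ->
  (forall P, ~ U P -> forall eta : R, (0 < eta)%R ->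
     exists d : posreal, forall z, U z -> (Cmod (z - P) < d)%R -> (Cmod (F z) <= B + eta)%R) ->
  forall z, U z -> (Cmod (F z) <= B)%R.
Proof.
intros HU Hr HF HB Hbd z1 Hz1.
apply Rnot_lt_le. intros Hlt.
assert (Hr0 : (0 <= r)%R) by (pose proof (Cmod_ge_0 z1); pose proof (Hr z1 Hz1); lra).
set (eps := ((Cmod (F z1) ^ 2 - B ^ 2) / (r ^ 2 + 1))%R).
assert (Hg : (0 < Cmod (F z1) ^ 2 - B ^ 2)%R) by nra.
assert (Hr2 : (0 < r ^ 2 + 1)%R) by nra.
assert (Heps : (0 < eps)%R) by (apply Rdiv_lt_0_compat; lra).
assert (Hsm : (B ^ 2 + eps * r ^ 2 < Cmod (F z1) ^ 2)%R).
{ assert (eps * (r ^ 2 + 1) = Cmod (F z1) ^ 2 - B ^ 2)%R by (unfold eps; field; lra). lra. }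
set (Phi := fun z => (Cmod (F z) ^ 2 + eps * Cmod z ^ 2)%R).
(* The same statement serves twice: to show that the supremum is finite and
   to keep away from it. *)
assert (Hloc : forall P eta, (0 < eta)%R -> exists d : posreal, forall z, U z -> (Cmod (z - P) < d)%R ->
   (U P -> (Cmod (F z) <= Cmod (F P) + eta /\ Cmod z <= Cmod P + eta)%R) /\
   (~ U P -> (Cmod (F z) <= B + eta)%R)).
{ intros P eta Heta. destruct (classic (U P)) as [HP|HP].
  - destruct (cder_continuous F P _ (proj1 HF P HP) eta Heta) as (d1 & Hd1).
    assert (Hp : (0 < Rmin d1 eta)%R) by (apply Rmin_pos; [apply d1 | exact Heta]).
    exists (mkposreal _ Hp). simpl. intros z Hz Hzd. split; [|tauto]. intros _.
    assert (Hz1' : (Cmod (z - P) < d1)%R) by (eapply Rlt_le_trans; [exact Hzd | apply Rmin_l]).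
    assert (Hz2' : (Cmod (z - P) < eta)%R) by (eapply Rlt_le_trans; [exact Hzd | apply Rmin_r]).
    specialize (Hd1 z Hz1'). pose proof (Cmod_triangle_rev (F z) (F P)).
    pose proof (Cmod_triangle_rev z P). lra.
  - destruct (Hbd P HP eta Heta) as (d & Hd). exists d. intros z Hz Hzd. split; [tauto|].
    intros _. apply Hd; assumption. }
assert (Hbound : exists d : posreal, forall z, U z -> (Phi z <= / d)%R).
{ apply (uniform_radius_on_bounded U r (fun d z => (Phi z <= / d)%R)).
  - exact Hr.
  - intros d d' z Hd H. eapply Rle_trans. exact H. apply Rinv_le_contravar; lra.
  - intros P. destruct (Hloc P 1%R Rlt_0_1) as (d & Hd).
    assert (HM : exists M, (0 < M)%R /\ forall z, U z -> (Cmod (z - P) < d)%R -> (Phi z <= M)%R).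
    { destruct (classic (U P)) as [HP|HP].
      - exists ((Cmod (F P) + 1) ^ 2 + eps * (Cmod P + 1) ^ 2 + 1)%R. split.
        + pose proof (pow2_ge_0 (Cmod (F P) + 1)). pose proof (pow2_ge_0 (Cmod P + 1)). nra.
        + intros z Hz Hzd. destruct (Hd z Hz Hzd) as (H & _). specialize (H HP).
          pose proof (Rsqr_sum_le (Cmod (F P) + 1) (Cmod P + 1) eps (Cmod (F z)) (Cmod z)).
          pose proof (Cmod_ge_0 (F z)). pose proof (Cmod_ge_0 z). unfold Phi. lra.
      - exists ((B + 1) ^ 2 + eps * r ^ 2 + 1)%R. split.
        + pose proof (pow2_ge_0 (B + 1)). nra.
        + intros z Hz Hzd. destruct (Hd z Hz Hzd) as (_ & H). specialize (H HP).
          pose proof (Rsqr_sum_le (B + 1) r eps (Cmod (F z)) (Cmod z)).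
          pose proof (Cmod_ge_0 (F z)). pose proof (Cmod_ge_0 z). pose proof (Hr z Hz). unfold Phi. lra. }
    destruct HM as (M & HM0 & HM).
    assert (Hp : (0 < Rmin d (/ M))%R) by (apply Rmin_pos; [apply d | apply Rinv_0_lt_compat, HM0]).
    exists (mkposreal _ Hp). simpl. intros z Hz Hzd.
    eapply Rle_trans. apply HM. exact Hz. eapply Rlt_le_trans. exact Hzd. apply Rmin_l.
    rewrite <- (Rinv_inv M) at 1. apply Rinv_le_contravar. exact Hp. apply Rmin_r. }
destruct Hbound as (d0 & Hd0).
destruct (completeness (fun v => exists z, U z /\ v = Phi z)) as (S & HS1 & HS2).
- exists (/ d0)%R. intros v (z & Hz & ->). apply Hd0, Hz.
- exists (Phi z1), z1. tauto.
- assert (HSz : forall z, U z -> (Phi z <= S)%R) by (intros z Hz; apply HS1; exists z; tauto).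
  assert (HSB : (B ^ 2 + eps * r ^ 2 < S)%R).
  { specialize (HSz z1 Hz1). unfold Phi in HSz. pose proof (pow2_ge_0 (Cmod z1)).
    assert (0 <= eps * Cmod z1 ^ 2)%R by (apply Rmult_le_pos; lra). lra. }
  destruct (uniform_radius_on_bounded U r (fun d z => (Phi z <= S - d)%R)) as (d & Hd).
  + exact Hr.
  + intros d d' z Hdd H. lra.
  + intros P.
    destruct (classic (U P)) as [HP|HP].
    * assert (HPS : (Phi P < S)%R).
      { destruct (Cmod2_no_local_max U F P eps HU HF HP Heps) as (z & Hz & Hzlt).
        specialize (HSz z Hz). unfold Phi in *. lra. }
      destruct (square_slack (Cmod (F P)) (Cmod P) eps S) as (eta & Heta & Hs).
      apply Cmod_ge_0. apply Cmod_ge_0. lra. exact HPS.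
      destruct (Hloc P eta Heta) as (d & Hd).
      assert (Hp : (0 < Rmin d eta)%R) by (apply Rmin_pos; [apply d | exact Heta]).
      exists (mkposreal _ Hp). simpl. intros z Hz Hzd.
      destruct (Hd z Hz) as (H & _). eapply Rlt_le_trans. exact Hzd. apply Rmin_l. specialize (H HP).
      pose proof (Rsqr_sum_le (Cmod (F P) + eta) (Cmod P + eta) eps (Cmod (F z)) (Cmod z)).
      pose proof (Cmod_ge_0 (F z)). pose proof (Cmod_ge_0 z). pose proof (Rmin_r d eta). unfold Phi. lra.
    * destruct (square_slack B r eps S) as (eta & Heta & Hs); try lra.
      destruct (Hloc P eta Heta) as (d & Hd).
      assert (Hp : (0 < Rmin d eta)%R) by (apply Rmin_pos; [apply d | exact Heta]).
      exists (mkposreal _ Hp). simpl. intros z Hz Hzd.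
      destruct (Hd z Hz) as (_ & H). eapply Rlt_le_trans. exact Hzd. apply Rmin_l. specialize (H HP).
      pose proof (Rsqr_sum_le (B + eta) (r + eta) eps (Cmod (F z)) (Cmod z)).
      pose proof (Cmod_ge_0 (F z)). pose proof (Cmod_ge_0 z). pose proof (Rmin_r d eta).
      pose proof (Hr z Hz). unfold Phi. lra.
  + assert (S <= S - d)%R.
    { apply HS2. intros v (z & Hz & ->). apply Hd, Hz. }
    pose proof (cond_pos d). lra.
Qed.

Lemma pow_unbounded x y : (1 < x)%R -> exists n, (y < x ^ n)%R.
Proof.
intros Hx. destruct (Pow_x_infinity x) with (b := (y + 1)%R) as (N & HN).
{ rewrite Rabs_pos_eq; lra. }
exists N. specialize (HN N (le_n _)). rewrite Rabs_pos_eq in HN. lra. apply pow_le. lra.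
Qed.

Definition punctured (r : R) (z : C) : Prop := (Cmod z < r)%R /\ z <> 0.

Lemma copen_punctured r : copen (punctured r).
Proof. apply copen_and. apply copen_ball. apply copen_nonzero. Qed.

(** The factor [z] in [z F^n] kills the bounded singularity at 0, so the
    maximum principle gives [|z| |F z|^n <= r B^n]; for fixed [z] and
    [n] tending to infinity this excludes [|F z| > B]. *)
Theorem maximum_principle_punctured (F : C -> C) (r R0 B K : R) (d0 : posreal) :
  (0 < r < R0)%R -> Ck 2 (punctured R0) F -> (0 < B)%R ->
  (forall z, Cmod z = r -> (Cmod (F z) <= B)%R) ->
  (forall z : C, z <> 0 -> (Cmod z < d0)%R -> (Cmod (F z) <= K)%R) ->
  forall z, punctured r z -> (Cmod (F z) <= B)%R.
Proof.
intros Hr HF HB Hcirc Hzero z1 Hz1.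
assert (Hpow : forall n, (Cmod z1 * Cmod (F z1) ^ n <= r * B ^ n)%R).
{ intros n. rewrite <- Cmod_pow, <- Cmod_mult.
  assert (HG : Ck 2 (punctured R0) (fun z => z * F z ^ n)).
  { apply Ck_mult. apply copen_punctured. apply Ck_id, copen_punctured. apply Ck_pow. apply copen_punctured. exact HF. }
  assert (Hmod : forall z, Cmod (z * F z ^ n) = (Cmod z * Cmod (F z) ^ n)%R).
  { intros z. rewrite Cmod_mult, Cmod_pow. reflexivity. }
  apply (maximum_principle (punctured r) (fun z => z * F z ^ n) r (r * B ^ n)).
  - apply copen_punctured.
  - intros z (Hz & _). lra.
  - apply (Ck_subset 2 (punctured R0)). 2: exact HG. intros z (Hz & Hz0). split. lra. exact Hz0.
  - apply Rmult_le_pos. lra. apply pow_le. lra.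
  - intros P HP eta Heta.
    assert (HBn : (0 < r * B ^ n)%R) by (apply Rmult_lt_0_compat; [lra | apply pow_lt, HB]).
    destruct (Ceq_dec P 0) as [->|HP0].
    + assert (HK : (0 < eta / (Rabs K ^ n + 1))%R).
      { apply Rdiv_lt_0_compat. lra. pose proof (pow_le (Rabs K) n (Rabs_pos K)). lra. }
      assert (Hp : (0 < Rmin d0 (eta / (Rabs K ^ n + 1)))%R) by (apply Rmin_pos; [apply d0 | exact HK]).
      exists (mkposreal _ Hp). simpl. intros z (Hz & Hz0) Hzd.
      replace (z - 0) with z in Hzd by ring.
      assert (H1 : (Cmod z < d0)%R) by (eapply Rlt_le_trans; [exact Hzd | apply Rmin_l]).
      assert (H2 : (Cmod z < eta / (Rabs K ^ n + 1))%R) by (eapply Rlt_le_trans; [exact Hzd | apply Rmin_r]).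
      rewrite Hmod.
      assert (H3 : (Cmod (F z) ^ n <= Rabs K ^ n)%R).
      { apply pow_incr. split. apply Cmod_ge_0. eapply Rle_trans. apply Hzero; assumption. apply Rle_abs. }
      pose proof (Cmod_ge_0 z) as H4.
      pose proof (pow_le (Rabs K) n (Rabs_pos K)) as H5.
      apply Rle_trans with (eta / (Rabs K ^ n + 1) * (Rabs K ^ n + 1))%R.
      * apply Rmult_le_compat; try lra. apply pow_le, Cmod_ge_0.
      * replace (eta / (Rabs K ^ n + 1) * (Rabs K ^ n + 1))%R with eta by (field; lra). lra.
    + destruct (Rtotal_order (Cmod P) r) as [Hlt|[Heq|Hgt]].
      * exfalso. apply HP. split; assumption.
      * assert (HPR : punctured R0 P) by (split; [lra | exact HP0]).
        destruct (cder_continuous _ P _ (proj1 HG P HPR) eta Heta) as (d & Hd).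
        exists d. intros z Hz Hzd. specialize (Hd z Hzd).
        pose proof (Cmod_triangle_rev (z * F z ^ n) (P * F P ^ n)) as Ht.
        rewrite (Hmod P), Heq in Ht.
        assert (r * Cmod (F P) ^ n <= r * B ^ n)%R.
        { apply Rmult_le_compat_l. lra. apply pow_incr. split. apply Cmod_ge_0. apply Hcirc, Heq. }
        lra.
      * assert (Hp : (0 < Cmod P - r)%R) by lra.
        exists (mkposreal _ Hp). simpl. intros z (Hz & _) Hzd.
        exfalso. rewrite Cmod_sub_sym in Hzd. pose proof (Cmod_triangle_rev P z). lra.
  - exact Hz1. }
apply Rnot_lt_le. intros Hlt.
destruct Hz1 as (_ & Hz1). assert (Hz0 : (0 < Cmod z1)%R) by (apply Cmod_gt_0, Hz1).
destruct (pow_unbounded (Cmod (F z1) / B) (r / Cmod z1)) as (n & Hn).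
{ apply Rmult_lt_reg_r with B. exact HB. unfold Rdiv. rewrite Rmult_assoc, Rinv_l; lra. }
specialize (Hpow n).
assert (HBn : (0 < B ^ n)%R) by (apply pow_lt, HB).
unfold Rdiv in Hn. rewrite Rpow_mult_distr, pow_inv in Hn.
apply Rmult_lt_compat_r with (r := (Cmod z1 * B ^ n)%R) in Hn.
2: apply Rmult_lt_0_compat; assumption.
replace (r * / Cmod z1 * (Cmod z1 * B ^ n))%R with (r * B ^ n)%R in Hn by (field; lra).
replace (Cmod (F z1) ^ n * / B ^ n * (Cmod z1 * B ^ n))%R with (Cmod z1 * Cmod (F z1) ^ n)%R in Hn by (field; lra).
lra.
Qed.

(** * Taylor expansion at the origin *)

(** The real mean value theorem applied to the real part of [c * g] along the
    segment from 0 to [z], where [c] is the conjugate of the increment, so that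
    the real part is the full squared modulus of the increment. *)
Lemma mean_value_bound (g dg : C -> C) (z : C) (K : R) :
  (forall t : R, (0 <= t <= 1)%R -> cder g (RtoC t * z) (dg (RtoC t * z)) /\
     (Cmod (dg (RtoC t * z)%C) <= K)%R) ->
  (Cmod (g z - g 0) <= K * Cmod z)%R.
Proof.
intros H.
set (c := Cconj (g z - g 0)).
set (phi := fun t : R => Re (c * g (0 + RtoC t * z))).
assert (H0 : forall t : R, 0 + RtoC t * z = RtoC t * z) by (intros t; ring).
destruct (MVT_cor2 phi (fun t => Re (z * (c * dg (RtoC t * z)))) 0 1) as (t & Heq & Ht).
- lra.
- intros t Ht. apply is_derive_Reals.
  destruct (H t Ht) as (Hd & _).
  apply (is_derive_line_re (fun x => c * g x)). rewrite H0.
  apply cder_eq with (0 * g (RtoC t * z) + c * dg (RtoC t * z)). 2: ring.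
  apply (cder_mult (fun _ => c)). apply cder_const. exact Hd.
- destruct (H t ltac:(lra)) as (_ & Hb).
  unfold phi in Heq.
  replace (0 + RtoC 1 * z) with z in Heq by ring.
  replace (0 + RtoC 0 * z) with (RtoC 0) in Heq by ring.
  assert (Hsq : (Re (c * g z) - Re (c * g 0) = Cmod (g z - g 0) ^ 2)%R).
  { unfold c. rewrite Cmod2_alt. destruct (g z), (g 0). simpl. ring. }
  assert (Hc : Cmod c = Cmod (g z - g 0)) by apply Cmod_conj.
  assert (Hle : (Cmod (g z - g 0) ^ 2 <= Cmod z * (Cmod (g z - g 0) * K))%R).
  { rewrite <- Hsq, Heq. replace (1 - 0)%R with 1%R by ring. rewrite Rmult_1_r.
    eapply Rle_trans. apply Rle_abs. eapply Rle_trans. apply re_le_Cmod.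
    rewrite !Cmod_mult, Hc. apply Rmult_le_compat_l. apply Cmod_ge_0.
    apply Rmult_le_compat_l. apply Cmod_ge_0. exact Hb. }
  destruct (Cmod_ge_0 (g z - g 0)) as [Hpos|Hz].
  + apply Rmult_le_reg_l with (Cmod (g z - g 0)). exact Hpos. lra.
  + rewrite <- Hz. apply Rmult_le_pos. 2: apply Cmod_ge_0.
    eapply Rle_trans. 2: exact Hb. apply Cmod_ge_0.
Qed.

(** The coefficient [f^(n)(0) / n!], with the factorial built up one factor per
    differentiation. *)
Fixpoint taylor (f : C -> C) (n : nat) : C :=
  match n with
  | O => f 0
  | S m => taylor (C_derive f) m / RtoC (INR (S m))
  end.

Lemma INR_S_neq0 n : RtoC (INR (S n)) <> 0.
Proof. intros H. apply RtoC_inj in H. revert H. apply not_0_INR. lia. Qed.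

Lemma coef_derive_taylor f n : coef_derive (taylor f) n = taylor (C_derive f) n.
Proof.
unfold coef_derive. change (taylor f (S n)) with (taylor (C_derive f) n / RtoC (INR (S n))).
pose proof (INR_S_neq0 n). field. assumption.
Qed.

Lemma cder_pow k z : cder (fun w => w ^ S k) z (RtoC (INR (S k)) * z ^ k).
Proof.
induction k as [|k IH].
- apply cder_ext with (fun w => w). { exists (mkposreal 1 Rlt_0_1). intros y _. simpl. ring. }
  apply cder_eq with (RtoC 1). apply cder_id. simpl. ring.
- apply (cder_eq _ _ (1 * z ^ S k + z * (RtoC (INR (S k)) * z ^ k))).
  + apply (cder_mult (fun w => w) (fun w => w ^ S k)). apply cder_id. exact IH.
  + rewrite (S_INR (S k)), RtoC_plus. rewrite (Cpow_S z k). ring.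
Qed.

Definition psum (a : nat -> C) (N : nat) (z : C) : C := csum (fun k => a k * z ^ k) N.

Lemma cder_psum (a : nat -> C) N z : cder (psum a (S N)) z (psum (coef_derive a) N z).
Proof.
induction N as [|N IH].
- apply cder_ext with (fun _ => a O).
  { exists (mkposreal 1 Rlt_0_1). intros y _. unfold psum. simpl. ring. }
  apply cder_const.
- change (psum (coef_derive a) (S N) z) with (psum (coef_derive a) N z + coef_derive a N * z ^ N).
  apply (cder_plus (psum a (S N)) (fun w => a (S N) * w ^ S N)). exact IH.
  apply cder_eq with (0 * z ^ S N + a (S N) * (RtoC (INR (S N)) * z ^ N)).
  apply (cder_mult (fun _ => a (S N))). apply cder_const. apply cder_pow.
  unfold coef_derive. ring.
Qed.

Lemma psum_0 (a : nat -> C) N : psum a (S N) 0 = a O.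
Proof.
unfold psum. rewrite csum_shift, (csum_ext _ (fun _ => 0)). rewrite csum_zero. simpl. ring.
intros k _. simpl. ring.
Qed.

(** Induction on the order: differentiating the remainder of [f] at order
    [N + 1] gives the remainder of [C_derive f] at order [N], and the mean value
    bound integrates the estimate. *)
Lemma taylor_remainder N : forall (R0 : R) f, (0 < R0)%R -> Ck (S N) (fun z => (Cmod z < R0)%R) f ->
  exists (K : R) (d : posreal), (0 <= K)%R /\ forall z, (Cmod z < d)%R ->
    (Cmod (f z - psum (taylor f) N z) <= K * Cmod z ^ N)%R.
Proof.
induction N as [|N IH]; intros R0 f HR (H1 & H2).
- destruct (cder_continuous f 0 _ (H1 0 ltac:(rewrite Cmod_0; exact HR)) 1%R Rlt_0_1) as (d & Hd).
  exists (Cmod (f 0) + 1)%R, d. split. { pose proof (Cmod_ge_0 (f 0)). lra. }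
  intros z Hz. unfold psum. simpl.
  replace (f z - 0) with (f z) by ring.
  specialize (Hd z). replace (z - 0) with z in Hd by ring. specialize (Hd Hz).
  pose proof (Cmod_triangle_rev (f z) (f 0)). lra.
- destruct (IH R0 (C_derive f) HR H2) as (K & d & HK & Hd).
  assert (Hp : (0 < Rmin d R0)%R) by (apply Rmin_pos; [apply d | exact HR]).
  exists K, (mkposreal _ Hp). split. exact HK. simpl pos. intros z Hz.
  assert (Hz1 : (Cmod z < d)%R) by (eapply Rlt_le_trans; [exact Hz | apply Rmin_l]).
  assert (Hz2 : (Cmod z < R0)%R) by (eapply Rlt_le_trans; [exact Hz | apply Rmin_r]).
  set (g := fun w => f w + (-1) * psum (taylor f) (S N) w).
  set (dg := fun w => C_derive f w - psum (taylor (C_derive f)) N w).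
  pose proof (mean_value_bound g dg z (K * Cmod z ^ N)) as Hm.
  replace (f z - psum (taylor f) (S N) z) with (g z - g 0).
  2:{ unfold g. rewrite psum_0. simpl taylor. ring. }
  replace (K * Cmod z ^ S N)%R with (K * Cmod z ^ N * Cmod z)%R by (simpl; ring).
  apply Hm. intros t Ht.
  assert (Htz : (Cmod (RtoC t * z) <= Cmod z)%R).
  { rewrite Cmod_mult, Cmod_R, Rabs_pos_eq by lra. pose proof (Cmod_ge_0 z). nra. }
  split.
  + unfold g, dg. apply (cder_eq _ _ (C_derive f (RtoC t * z) +
       (0 * psum (taylor f) (S N) (RtoC t * z) + (-1) * psum (coef_derive (taylor f)) N (RtoC t * z)))).
    * apply cder_plus. apply H1. lra.
      apply (cder_mult (fun _ => -1) (psum (taylor f) (S N))).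
      apply cder_const. apply cder_psum.
    * unfold psum at 2 3. rewrite (csum_ext _ (fun k => taylor (C_derive f) k * (RtoC t * z) ^ k)).
      ring. intros k _. rewrite coef_derive_taylor. reflexivity.
  + eapply Rle_trans. apply Hd. lra.
    apply Rmult_le_compat_l. exact HK. apply pow_incr. split. apply Cmod_ge_0. exact Htz.
Qed.

(** * Roots of unity and discrete Parseval *)

Lemma moivre t n : (cos t, sin t)%R ^ n = (cos (INR n * t), sin (INR n * t))%R :> C.
Proof.
induction n as [|n IH].
- simpl. rewrite Rmult_0_l, cos_0, sin_0. reflexivity.
- rewrite Cpow_S, IH, S_INR.
  replace ((INR n + 1) * t)%R with (t + INR n * t)%R by ring.
  rewrite cos_plus, sin_plus. unfold Cmult. simpl. f_equal; ring.
Qed.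

Lemma primitive_root N : (1 <= N)%nat ->
  exists w : C, Cmod w = 1%R /\ w ^ N = 1 /\ forall d, (0 < d < N)%nat -> w ^ d <> 1.
Proof.
intros HN.
assert (HN0 : (0 < INR N)%R) by (apply lt_0_INR; lia).
set (t := (2 * PI / INR N)%R).
exists (cos t, sin t)%R. split; [|split].
- unfold Cmod. simpl. replace (cos t * (cos t * 1) + sin t * (sin t * 1))%R with 1%R.
  apply sqrt_1. pose proof (sin2_cos2 t). unfold Rsqr in H. lra.
- rewrite moivre. replace (INR N * t)%R with (2 * PI)%R by (unfold t; field; lra).
  rewrite cos_2PI, sin_2PI. reflexivity.
- intros d Hd. rewrite moivre. intros H. injection H as Hc _.
  set (x := (INR d * PI / INR N)%R).
  assert (Hx : (INR d * t = 2 * x)%R) by (unfold t, x; field; lra).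
  rewrite Hx, cos_2a_sin in Hc.
  assert (Hd0 : (0 < INR d)%R) by (apply lt_0_INR; lia).
  assert (HdN : (INR d < INR N)%R) by (apply lt_INR; lia).
  pose proof PI_RGT_0 as Hpi.
  assert (Hs : (0 < sin x)%R).
  { apply sin_gt_0.
    - unfold x. apply Rdiv_lt_0_compat; nra.
    - unfold x. apply Rmult_lt_reg_r with (INR N). exact HN0.
      unfold Rdiv. rewrite Rmult_assoc, Rinv_l by lra. nra. }
  nra.
Qed.

Lemma csum_geom (y : C) N : (y - 1) * csum (fun j => y ^ j) N = y ^ N - 1.
Proof. induction N as [|N IH]; simpl. ring. rewrite Cmult_plus_distr_l, IH. ring. Qed.

Lemma csum_const (c : C) N : csum (fun _ => c) N = RtoC (INR N) * c.
Proof. induction N as [|N IH]. simpl. ring. simpl csum. rewrite IH, S_INR, RtoC_plus. ring. Qed.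

Lemma Cpow_inv_cancel (w : C) n : w <> 0 -> w ^ n * (/ w) ^ n = 1.
Proof. intros Hw. rewrite <- Cpow_mult_l, Cinv_r, Cpow_1_l; auto. Qed.

(** A geometric sum whose ratio [w^n / w^k] is an [N]-th root of unity different
    from 1 unless [n = k]. *)
Lemma root_orthogonality (w : C) N n k : w <> 0 -> w ^ N = 1 ->
  (forall d, (0 < d < N)%nat -> w ^ d <> 1) -> (n < N)%nat -> (k < N)%nat ->
  csum (fun j => (w ^ j) ^ n * ((/ w) ^ j) ^ k) N = if Nat.eq_dec n k then RtoC (INR N) else 0.
Proof.
intros Hw HN Hd Hn Hk.
set (y := w ^ n * (/ w) ^ k).
rewrite (csum_ext _ (fun j => y ^ j)).
2:{ intros j _. unfold y. rewrite Cpow_mult_l, <- !Cpow_mult_r, (Nat.mul_comm n), (Nat.mul_comm k). reflexivity. }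
destruct (Nat.eq_dec n k) as [->|Hne].
- rewrite (csum_ext _ (fun _ => 1)). rewrite csum_const. ring.
  intros j _. unfold y. rewrite Cpow_inv_cancel, Cpow_1_l; auto.
- assert (HyN : y ^ N = 1).
  { unfold y. rewrite Cpow_mult_l, <- !Cpow_mult_r, (Nat.mul_comm n), (Nat.mul_comm k), !Cpow_mult_r, HN.
    rewrite Cpow_inv, HN by exact Hw. rewrite !Cpow_1_l. replace (/ 1) with (RtoC 1) by field.
    rewrite Cpow_1_l. ring. }
  assert (Hy1 : y - 1 <> 0).
  { intros Hy.
    assert (He : w ^ n = w ^ k).
    { replace (w ^ n) with (y * w ^ k). replace y with ((y - 1) + 1) by ring. rewrite Hy. ring.
      unfold y. rewrite <- Cmult_assoc, (Cmult_comm ((/ w) ^ k)), Cpow_inv_cancel by exact Hw. ring. }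
    assert (Haux : forall a b, (a < b < N)%nat -> w ^ b = w ^ a -> False).
    { intros a b Hab Heq. apply (Hd (b - a)%nat). lia.
      replace (w ^ b) with (w ^ (b - a) * w ^ a) in Heq.
      2:{ rewrite <- Cpow_add_r. f_equal. lia. }
      replace (w ^ (b - a)) with (w ^ (b - a) * w ^ a * (/ w) ^ a).
      rewrite Heq. apply Cpow_inv_cancel, Hw.
      rewrite <- Cmult_assoc, Cpow_inv_cancel by exact Hw. ring. }
    destruct (Nat.lt_total n k) as [H|[H|H]].
    - apply (Haux n k). lia. symmetry. exact He.
    - contradiction.
    - apply (Haux k n). lia. exact He. }
  pose proof (csum_geom y N) as Hg. rewrite HyN in Hg.
  destruct (Ceq_dec (csum (fun j => y ^ j) N) 0) as [H|H]. exact H.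
  exfalso. apply (Cmult_neq_0 _ _ Hy1 H). rewrite Hg. ring.
Qed.

Lemma Cconj_csum u n : Cconj (csum u n) = csum (fun k => Cconj (u k)) n.
Proof. induction n as [|n IH]; simpl. unfold Cconj; simpl. unfold RtoC. f_equal; ring. rewrite Cplus_conj, IH. reflexivity. Qed.

Lemma csum_RtoC (u : nat -> R) n : csum (fun k => RtoC (u k)) n = RtoC (rsum u n).
Proof. induction n as [|n IH]; simpl. reflexivity. rewrite IH, RtoC_plus. reflexivity. Qed.

Lemma csum_mult (u v : nat -> C) n m :
  csum u n * csum v m = csum (fun i => csum (fun j => u i * v j) m) n.
Proof.
induction n as [|n IH]; simpl. ring. rewrite Cmult_plus_distr_r, IH, csum_scal. reflexivity.
Qed.

(** Averaged over the rotations by [w], only the diagonal terms of the product of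
    a polynomial in [z] and a polynomial in the inverse rotation survive. *)
Lemma csum_mult_root (a b : nat -> C) (w z y : C) N : w <> 0 -> w ^ N = 1 ->
  (forall d, (0 < d < N)%nat -> w ^ d <> 1) ->
  csum (fun j => psum a N (w ^ j * z) * psum b N ((/ w) ^ j * y)) N
   = RtoC (INR N) * csum (fun n => a n * b n * (z * y) ^ n) N.
Proof.
intros Hw HN Hd.
rewrite (csum_ext _ (fun j => csum (fun n => csum (fun k =>
   (a n * b k * z ^ n * y ^ k) * ((w ^ j) ^ n * ((/ w) ^ j) ^ k)) N) N)).
2:{ intros j _. unfold psum. rewrite csum_mult. apply csum_ext. intros n _. apply csum_ext. intros k _.
    rewrite !Cpow_mult_l. ring. }
rewrite csum_swap, <- csum_scal. apply csum_ext. intros n Hn.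
rewrite csum_swap.
rewrite (csum_ext _ (fun k => (a n * b k * z ^ n * y ^ k) * (if Nat.eq_dec n k then RtoC (INR N) else 0))).
2:{ intros k Hk. rewrite csum_scal, root_orthogonality by assumption. reflexivity. }
rewrite (csum_single _ n).
- destruct (Nat.eq_dec n n) as [_|H]. 2: contradiction. rewrite Cpow_mult_l. ring.
- exact Hn.
- intros k Hk Hne. destruct (Nat.eq_dec n k) as [->|_]. contradiction. ring.
Qed.

(** [csum_mult_root] for the polynomial and its conjugate: on the unit circle
    conjugation is inversion, which turns the pairing into a sum of squared
    moduli. *)
Lemma discrete_parseval (b : nat -> C) (w y : C) N : Cmod w = 1%R -> w ^ N = 1 ->
  (forall d, (0 < d < N)%nat -> w ^ d <> 1) -> Cmod y = 1%R ->
  rsum (fun j => Cmod (psum b N ((/ w) ^ j * y)) ^ 2)%R N = (INR N * rsum (fun k => Cmod (b k) ^ 2) N)%R.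
Proof.
intros Hw1 HN Hd Hy1.
assert (Hw : w <> 0) by (intros ->; rewrite Cmod_0 in Hw1; lra).
assert (Hunit : forall u, Cmod u = 1%R -> u * Cconj u = 1).
{ intros u Hu. rewrite <- Cmod2_conj, Hu. simpl. rewrite !Rmult_1_r. reflexivity. }
assert (Hwc : Cconj (/ w) = w).
{ replace (Cconj (/ w)) with (w * (/ w * Cconj (/ w))). 2: field_simplify; [reflexivity | assumption].
  rewrite Hunit. ring. rewrite Cmod_inv, Hw1 by exact Hw. field. }
apply RtoC_inj. rewrite RtoC_mult, <- !csum_RtoC.
rewrite (csum_ext _ (fun j => psum (fun k => Cconj (b k)) N (w ^ j * Cconj y) * psum b N ((/ w) ^ j * y))).
- rewrite csum_mult_root by assumption. f_equal. apply csum_ext. intros k _.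
  rewrite (Cmult_comm (Cconj y)), Hunit, Cpow_1_l by exact Hy1.
  rewrite Cmod2_conj. ring.
- intros j _. rewrite Cmod2_conj, Cmult_comm. f_equal.
  unfold psum. rewrite Cconj_csum. apply csum_ext. intros k _.
  rewrite Cmult_conj, Cpow_conj, Cmult_conj, Cpow_conj, Hwc. reflexivity.
Qed.

(** The mean is at most the quadratic mean.  Instead of Cauchy-Schwarz the proof
    sums [2 s |Q| <= s^2 + |Q|^2], which avoids square roots. *)
Lemma discrete_mean_bound (b : nat -> C) (w y : C) N s : Cmod w = 1%R -> w ^ N = 1 ->
  (forall d, (0 < d < N)%nat -> w ^ d <> 1) -> Cmod y = 1%R -> (0 < s)%R ->
  (rsum (fun k => Cmod (b k) ^ 2) N <= s ^ 2)%R ->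
  (rsum (fun j => Cmod (psum b N ((/ w) ^ j * y)%C)) N <= INR N * s)%R.
Proof.
intros Hw HN Hd Hy Hs Hb.
apply Rmult_le_reg_l with (2 * s)%R. lra.
rewrite <- rsum_scal.
apply Rle_trans with (rsum (fun j => s ^ 2 + Cmod (psum b N ((/ w) ^ j * y)%C) ^ 2)%R N).
- apply rsum_le. intros j _. pose proof (pow2_ge_0 (s - Cmod (psum b N ((/ w) ^ j * y)))). nra.
- assert (Hsplit : forall u v n, rsum (fun k => u k + v k)%R n = (rsum u n + rsum v n)%R).
  { intros u v n. induction n as [|n IH]; simpl. ring. rewrite IH. ring. }
  rewrite Hsplit, rsum_const, discrete_parseval by assumption.
  pose proof (pos_INR N). nra.
Qed.

(** * Coefficient bounds and convergence of Taylor series *)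

Notation disk R0 := (fun z : C => (Cmod z < R0)%R).

(** With [Q] the polynomial of coefficients [q], let [H z] be the average of
    [f (v z) * Q (r / (v z))] over the [N]-th roots of unity [v].  Near 0 the
    Taylor polynomial of [f] contributes exactly the pairing [A] of the
    coefficients, by orthogonality, and the remainder, of order [z^N], beats the
    pole of order [N - 1] of [Q (r / z)]; so [H] tends to [A].  On the circle of
    radius [r], [|H|] is at most [M] times the mean of [|Q|].  The maximum
    principle transfers this bound to [A]. *)
Theorem coefficient_functional_bound (f : C -> C) (R0 r M s : R) (q : nat -> C) (N : nat) :
  (0 < r < R0)%R -> (forall n, Ck n (disk R0) f) -> (0 < M)%R ->
  (forall z, Cmod z = r -> (Cmod (f z) <= M)%R) ->
  (0 < s)%R -> (rsum (fun k => Cmod (q k) ^ 2) N <= s ^ 2)%R ->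
  (Cmod (csum (fun k => (q k * taylor f k * RtoC r ^ k)%C) N) <= M * s)%R.
Proof.
intros Hr Hf HM Hcirc Hs Hq.
destruct (Nat.eq_dec N 0) as [->|HN0].
{ simpl. rewrite Cmod_0. nra. }
destruct (primitive_root N ltac:(lia)) as (w & Hw1 & HwN & Hwd).
assert (Hw : w <> 0) by (intros ->; rewrite Cmod_0 in Hw1; lra).
assert (HNpos : (0 < INR N)%R) by (apply lt_0_INR; lia).
assert (HNC : RtoC (INR N) <> 0) by (intros H; apply RtoC_inj in H; lra).
assert (Hwj : forall j, Cmod (w ^ j) = 1%R) by (intros j; rewrite Cmod_pow, Hw1; apply pow1).
set (A := csum (fun k => q k * taylor f k * RtoC r ^ k) N).
set (H := fun z => / RtoC (INR N) * csum (fun j => f (w ^ j * z + 0) * psum q N ((/ w) ^ j * (RtoC r * / z))) N).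
assert (HO : copen (punctured R0)) by apply copen_punctured.
assert (HH : Ck 2 (punctured R0) H).
{ unfold H. apply Ck_mult. exact HO. apply Ck_const, HO.
  apply (Ck_csum 2 (punctured R0) (fun j z => f (w ^ j * z + 0) * psum q N ((/ w) ^ j * (RtoC r * / z)))).
  exact HO. intros j. apply Ck_mult. exact HO.
  - apply (Ck_subset 2 (fun z => (Cmod (w ^ j * z + 0) < R0)%R)).
    + intros z (Hz & _). rewrite Cplus_0_r, Cmod_mult, Hwj. lra.
    + apply (Ck_affine 2 (disk R0) f (w ^ j) 0). apply copen_ball. apply Hf.
      apply (copen_affine (disk R0)). apply copen_ball.
  - unfold psum. apply (Ck_csum 2 (punctured R0) (fun k z => q k * ((/ w) ^ j * (RtoC r * / z)) ^ k)). exact HO.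
    intros k. apply Ck_mult. exact HO. apply Ck_const, HO. apply Ck_pow. exact HO.
    apply Ck_mult. exact HO. apply Ck_const, HO. apply Ck_mult. exact HO. apply Ck_const, HO.
    apply Ck_inv. exact HO. intros z (_ & Hz). exact Hz. apply Ck_id, HO. }
assert (Hnear : exists (L : R) (d : posreal), (0 <= L)%R /\ forall z : C, z <> 0 -> (Cmod z < d)%R ->
   (Cmod (H z - A) <= L * Cmod z)%R).
{ destruct (taylor_remainder N R0 f) as (K & d & HK & Hd). lra. apply Hf.
  set (Sq := rsum (fun k => Cmod (q k)) N).
  assert (HSq : (0 <= Sq)%R).
  { unfold Sq. rewrite <- (Rmult_0_r (INR N)), <- rsum_const. apply rsum_le. intros; apply Cmod_ge_0. }
  assert (Hp : (0 < Rmin d r)%R) by (apply Rmin_pos; [apply d | lra]).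
  exists (K * (r ^ (N - 1) * Sq))%R, (mkposreal _ Hp). split.
  { apply Rmult_le_pos. exact HK. apply Rmult_le_pos. apply pow_le; lra. exact HSq. }
  simpl. intros z Hz Hzd.
  assert (Hzd' : (Cmod z < d)%R) by (eapply Rlt_le_trans; [exact Hzd | apply Rmin_l]).
  assert (Hzr : (Cmod z < r)%R) by (eapply Rlt_le_trans; [exact Hzd | apply Rmin_r]).
  assert (Hz0 : (0 < Cmod z)%R) by (apply Cmod_gt_0, Hz).
  replace (H z - A) with (/ RtoC (INR N) * csum (fun j =>
     (f (w ^ j * z + 0) - psum (taylor f) N (w ^ j * z)) * psum q N ((/ w) ^ j * (RtoC r * / z))) N).
  2:{ unfold H, A.
      rewrite (csum_ext (fun j => (f (w ^ j * z + 0) - psum (taylor f) N (w ^ j * z)) * psum q N ((/ w) ^ j * (RtoC r * / z)))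
        (fun j => f (w ^ j * z + 0) * psum q N ((/ w) ^ j * (RtoC r * / z))
          + (-1) * (psum (taylor f) N (w ^ j * z) * psum q N ((/ w) ^ j * (RtoC r * / z)))))
        by (intros; ring).
      rewrite csum_plus, csum_scal, csum_mult_root by assumption.
      replace (z * (RtoC r * / z)) with (RtoC r) by (field; exact Hz).
      rewrite (csum_ext (fun k => q k * taylor f k * RtoC r ^ k) (fun k => taylor f k * q k * RtoC r ^ k)) by (intros; ring).
      field. exact HNC. }
  rewrite Cmod_mult, Cmod_inv, Cmod_INR by exact HNC.
  apply Rmult_le_reg_l with (INR N). exact HNpos.
  rewrite <- Rmult_assoc, Rinv_r, Rmult_1_l by lra.
  eapply Rle_trans. apply Cmod_csum. rewrite <- rsum_const.
  apply rsum_le. intros j _. rewrite Cplus_0_r, Cmod_mult.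
  assert (Hm : Cmod (w ^ j * z) = Cmod z) by (rewrite Cmod_mult, Hwj; ring).
  apply Rle_trans with (K * Cmod z ^ N * rsum (fun k => Cmod (q k) * (r / Cmod z) ^ k)%R N)%R.
  - apply Rmult_le_compat; try apply Cmod_ge_0.
    + rewrite <- Hm. apply Hd. rewrite Hm. exact Hzd'.
    + unfold psum. eapply Rle_trans. apply Cmod_csum. apply rsum_le. intros k _.
      rewrite Cmod_mult, Cmod_pow. right. f_equal. f_equal.
      rewrite !Cmod_mult, Cmod_pow, (Cmod_inv w), (Cmod_inv z), Hw1, Cmod_R, (Rabs_pos_eq r) by (assumption || lra).
      rewrite Rinv_1, pow1. unfold Rdiv. ring.
  - rewrite !Rmult_assoc. apply Rmult_le_compat_l. exact HK.
    rewrite <- rsum_scal. unfold Sq.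
    replace (r ^ (N - 1) * (rsum (fun k => Cmod (q k)) N * Cmod z))%R with
      (rsum (fun k => (r ^ (N - 1) * Cmod z) * Cmod (q k))%R N) by (rewrite rsum_scal; ring).
    apply rsum_le. intros k Hk.
    replace (Cmod z ^ N * (Cmod (q k) * (r / Cmod z) ^ k))%R with
      ((Cmod z ^ (N - 1 - k) * r ^ k * Cmod z) * Cmod (q k))%R.
    + apply Rmult_le_compat_r. apply Cmod_ge_0. apply Rmult_le_compat_r. lra.
      replace (N - 1)%nat with ((N - 1 - k) + k)%nat at 2 by lia. rewrite pow_add.
      apply Rmult_le_compat_r. apply pow_le; lra. apply pow_incr. lra.
    + replace N with ((N - 1 - k) + k + 1)%nat at 2 by lia. rewrite !pow_add. unfold Rdiv.
      rewrite Rpow_mult_distr, pow_inv. field. apply pow_nonzero. lra. }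
destruct Hnear as (L & d & HL & Hd).
assert (Hon : forall z, Cmod z = r -> (Cmod (H z) <= M * s)%R).
{ intros z Hz.
  assert (Hz0 : z <> 0) by (intros ->; rewrite Cmod_0 in Hz; lra).
  unfold H. rewrite Cmod_mult, Cmod_inv, Cmod_INR by exact HNC.
  apply Rmult_le_reg_l with (INR N). exact HNpos.
  rewrite <- Rmult_assoc, Rinv_r, Rmult_1_l by lra.
  eapply Rle_trans. apply Cmod_csum.
  apply Rle_trans with (M * (INR N * s))%R. 2: right; ring.
  eapply Rle_trans. 2: apply Rmult_le_compat_l; [lra|].
  2: apply (discrete_mean_bound q w (RtoC r * / z) N s); try assumption.
  - rewrite <- rsum_scal. apply rsum_le. intros j _. rewrite Cmod_mult.
    apply Rmult_le_compat_r. apply Cmod_ge_0. apply Hcirc. rewrite Cplus_0_r, Cmod_mult, Hwj, Hz. ring.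
  - rewrite Cmod_mult, Cmod_inv, Cmod_R, Rabs_pos_eq, Hz by (assumption || lra). field. lra. }
assert (Hin : forall z, punctured r z -> (Cmod (H z) <= M * s)%R).
{ apply (maximum_principle_punctured H r R0 (M * s) (Cmod A + L * d) d); try assumption.
  - apply Rmult_lt_0_compat; assumption.
  - intros z Hz Hzd. specialize (Hd z Hz Hzd).
    pose proof (Cmod_triangle_rev (H z) A). assert (L * Cmod z <= L * d)%R by (apply Rmult_le_compat_l; lra). lra. }
apply le_epsilon. intros eps He.
assert (Hp : (0 < Rmin (Rmin d r) (eps / (L + 1)))%R).
{ apply Rmin_pos. apply Rmin_pos. apply d. lra. apply Rdiv_lt_0_compat; lra. }
set (x := (Rmin (Rmin d r) (eps / (L + 1)) / 2)%R).
assert (Hx0 : (0 < x)%R) by (unfold x; lra).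
assert (Hxd : (x < d)%R) by (pose proof (Rmin_l (Rmin d r) (eps / (L + 1))); pose proof (Rmin_l d r); unfold x; lra).
assert (Hxr : (x < r)%R) by (pose proof (Rmin_l (Rmin d r) (eps / (L + 1))); pose proof (Rmin_r d r); unfold x; lra).
assert (Hxe : (x <= eps / (L + 1))%R) by (pose proof (Rmin_r (Rmin d r) (eps / (L + 1))); unfold x; lra).
assert (HxC : RtoC x <> 0) by (intros E; apply RtoC_inj in E; lra).
assert (HxM : Cmod (RtoC x) = x) by (rewrite Cmod_R; apply Rabs_pos_eq; lra).
specialize (Hd (RtoC x) HxC). rewrite HxM in Hd. specialize (Hd Hxd).
specialize (Hin (RtoC x)). assert (Hpx : punctured r (RtoC x)) by (split; [rewrite HxM; exact Hxr | exact HxC]).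
specialize (Hin Hpx). rewrite Cmod_sub_sym in Hd.
pose proof (Cmod_triangle_rev A (H (RtoC x))).
assert (L * x <= eps)%R.
{ apply Rle_trans with ((L + 1) * (eps / (L + 1)))%R. apply Rmult_le_compat; lra. right. field. lra. }
lra.
Qed.

(** The coefficient functional that reads off a single coefficient. *)
Lemma cauchy_estimate (f : C -> C) (R0 r M : R) n :
  (0 < r < R0)%R -> (forall n, Ck n (disk R0) f) -> (0 < M)%R ->
  (forall z, Cmod z = r -> (Cmod (f z) <= M)%R) ->
  (Cmod (taylor f n) * r ^ n <= M)%R.
Proof.
intros Hr Hf HM Hcirc.
set (q := fun k => if Nat.eq_dec k n then RtoC 1 else RtoC 0).
pose proof (coefficient_functional_bound f R0 r M 1 q (S n) Hr Hf HM Hcirc Rlt_0_1) as H.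
rewrite (csum_single _ n) in H.
- unfold q at 2 in H. destruct (Nat.eq_dec n n) as [_|Hn]. 2: contradiction.
  rewrite !Cmod_mult, Cmod_pow, Cmod_1, Cmod_R, (Rabs_pos_eq r), Rmult_1_l, Rmult_1_r in H by lra.
  apply H.
  apply Req_le. apply RtoC_inj. rewrite <- csum_RtoC, (csum_single _ n).
  + unfold q. destruct (Nat.eq_dec n n) as [_|Hn]. 2: contradiction. rewrite Cmod_1. f_equal.
  + lia.
  + intros j _ Hj. unfold q. destruct (Nat.eq_dec j n). contradiction. rewrite Cmod_0. f_equal. ring.
- lia.
- intros j _ Hj. unfold q. destruct (Nat.eq_dec j n). contradiction. ring.
Qed.

Lemma rsum_geom_le (x : R) n : (0 <= x < 1)%R -> (rsum (fun k => x ^ k)%R n <= / (1 - x))%R.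
Proof.
intros Hx.
assert (H : ((1 - x) * rsum (fun k => x ^ k)%R n = 1 - x ^ n)%R).
{ induction n as [|n IH]; simpl. ring. rewrite Rmult_plus_distr_l, IH. ring. }
apply Rmult_le_reg_l with (1 - x)%R. lra. rewrite H, Rinv_r by lra.
pose proof (pow_le x n ltac:(lra)). lra.
Qed.

Lemma circle_bounded (f : C -> C) (r R0 : R) : (0 < r < R0)%R -> Ck 1 (disk R0) f ->
  exists M, (0 < M)%R /\ forall z, Cmod z = r -> (Cmod (f z) <= M)%R.
Proof.
intros Hr (Hf & _).
destruct (uniform_radius_on_bounded (fun z => Cmod z = r) r (fun d z => (Cmod (f z) <= / d)%R)) as (d & Hd).
- intros z Hz. lra.
- intros d d' z Hd H. eapply Rle_trans. exact H. apply Rinv_le_contravar; lra.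
- intros P.
  destruct (Rlt_le_dec (Cmod P) R0) as [HP|HP].
  + destruct (cder_continuous f P _ (Hf P HP) 1%R Rlt_0_1) as (d & Hd).
    set (M := (Cmod (f P) + 1)%R).
    assert (HM : (0 < M)%R) by (unfold M; pose proof (Cmod_ge_0 (f P)); lra).
    assert (Hp : (0 < Rmin d (/ M))%R) by (apply Rmin_pos; [apply d | apply Rinv_0_lt_compat, HM]).
    exists (mkposreal _ Hp). simpl. intros z Hz Hzd.
    apply Rle_trans with M.
    * specialize (Hd z). pose proof (Cmod_triangle_rev (f z) (f P)).
      assert (Hlt : (Cmod (z - P) < d)%R) by (eapply Rlt_le_trans; [exact Hzd | apply Rmin_l]).
      specialize (Hd Hlt). unfold M. lra.
    * rewrite <- (Rinv_inv M) at 1. apply Rinv_le_contravar. exact Hp. apply Rmin_r.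
  + assert (Hp : (0 < Cmod P - r)%R) by lra.
    exists (mkposreal _ Hp). simpl. intros z Hz Hzd. exfalso.
    rewrite Cmod_sub_sym in Hzd. pose proof (Cmod_triangle_rev P z). lra.
- exists (/ d)%R. split. apply Rinv_0_lt_compat, d. exact Hd.
Qed.

(** The maximum principle for the remainder divided by [z^N] on the disk of
    radius [r1].  Cauchy's estimates on a larger circle [r2] bound the Taylor
    polynomials on the circle [r1] independently of [N], so the remainder at [z]
    is at most a constant times [(|z| / r1)^N]. *)
Theorem taylor_series_converges (f : C -> C) (R0 : R) : (forall n, Ck n (disk R0) f) ->
  forall z, (Cmod z < R0)%R -> climit (csum (fun k => taylor f k * z ^ k)) (f z).
Proof.
intros Hf z Hz.
assert (Hz0 := Cmod_ge_0 z).
set (r1 := ((Cmod z + R0) / 2)%R). set (r2 := ((r1 + R0) / 2)%R).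
assert (Hr : (Cmod z < r1 < r2 /\ r2 < R0)%R) by (unfold r2, r1; lra).
destruct (circle_bounded f r1 R0) as (M1 & HM1 & Hc1). lra. apply Hf.
destruct (circle_bounded f r2 R0) as (M2 & HM2 & Hc2). lra. apply Hf.
assert (Hrr : (0 <= r1 / r2 < 1)%R).
{ split. apply Rmult_le_pos. lra. apply Rlt_le, Rinv_0_lt_compat. lra.
  apply Rmult_lt_reg_r with r2. lra. unfold Rdiv. rewrite Rmult_assoc, Rinv_l; lra. }
set (B := (M1 + M2 * / (1 - r1 / r2))%R).
assert (HB : (0 < B)%R).
{ unfold B. apply Rplus_lt_le_0_compat. exact HM1. apply Rmult_le_pos. lra.
  apply Rlt_le, Rinv_0_lt_compat. lra. }
assert (Hcirc : forall N y, Cmod y = r1 -> (Cmod (f y - psum (taylor f) N y) <= B)%R).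
{ intros N y Hy. eapply Rle_trans. apply Cmod_triangle_sub. apply Rplus_le_compat. apply Hc1, Hy.
  unfold psum. eapply Rle_trans. apply Cmod_csum.
  eapply Rle_trans with (rsum (fun k => M2 * (r1 / r2) ^ k)%R N).
  - apply rsum_le. intros k _. rewrite Cmod_mult, Cmod_pow, Hy.
    pose proof (cauchy_estimate f R0 r2 M2 k ltac:(lra) Hf HM2 Hc2) as Hk.
    unfold Rdiv. rewrite Rpow_mult_distr, pow_inv.
    assert (Hp2 : (0 < r2 ^ k)%R) by (apply pow_lt; lra).
    assert (Hp1 : (0 <= r1 ^ k)%R) by (apply pow_le; lra).
    replace (Cmod (taylor f k) * r1 ^ k)%R with ((Cmod (taylor f k) * r2 ^ k) * (r1 ^ k * / r2 ^ k))%R by (field; lra).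
    apply Rmult_le_compat_r. apply Rmult_le_pos. lra. apply Rlt_le, Rinv_0_lt_compat, Hp2. exact Hk.
  - rewrite rsum_scal. apply Rmult_le_compat_l. lra. apply rsum_geom_le, Hrr. }
assert (Hrem : forall N, (Cmod (f z - psum (taylor f) (S N) z) <= B * (Cmod z / r1) ^ S N)%R).
(* The order is at least 1, so that the remainder vanishes at 0 itself, where
   dividing by [z^N] says nothing. *)
{ intros N0. set (N := S N0). destruct (Ceq_dec z 0) as [->|Hzn].
  - unfold N. rewrite psum_0, Cmod_0. simpl taylor. replace (f 0 - f 0) with (RtoC 0) by ring.
    rewrite Cmod_0. apply Rmult_le_pos. lra. apply pow_le. unfold Rdiv. rewrite Rmult_0_l. lra.
  - assert (HO : copen (punctured R0)) by apply copen_punctured.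
    set (F := fun y => (f y - psum (taylor f) N y) * (/ y) ^ N).
    assert (HF : Ck 2 (punctured R0) F).
    { apply Ck_mult. exact HO. apply Ck_minus. exact HO.
      apply (Ck_subset 2 (disk R0)). intros y (Hy & _). exact Hy. apply Hf.
      unfold psum. apply (Ck_csum 2 (punctured R0) (fun k y => taylor f k * y ^ k)). exact HO.
      intros k. apply Ck_mult. exact HO. apply Ck_const, HO. apply Ck_pow. exact HO. apply Ck_id, HO.
      apply Ck_pow. exact HO. apply Ck_inv. exact HO. intros y (_ & Hy). exact Hy. apply Ck_id, HO. }
    assert (HFm : forall y : C, y <> 0 -> Cmod (F y) = (Cmod (f y - psum (taylor f) N y) * / Cmod y ^ N)%R).
    { intros y Hy. unfold F. rewrite Cmod_mult, Cmod_pow, Cmod_inv, pow_inv by exact Hy. reflexivity. }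
    destruct (taylor_remainder N R0 f) as (K & d & HK & Hd). lra. apply Hf.
    pose proof (maximum_principle_punctured F r1 R0 (B * / r1 ^ N) K d) as HMP.
    assert (Hp1 : (0 < r1 ^ N)%R) by (apply pow_lt; lra).
    assert (HFz : (Cmod (F z) <= B * / r1 ^ N)%R).
    { apply HMP; try assumption.
      - lra.
      - apply Rmult_lt_0_compat. exact HB. apply Rinv_0_lt_compat, Hp1.
      - intros y Hy. rewrite HFm, Hy. apply Rmult_le_compat_r. apply Rlt_le, Rinv_0_lt_compat, Hp1.
        apply Hcirc, Hy. intros ->. rewrite Cmod_0 in Hy. lra.
      - intros y Hy Hyd. rewrite HFm by exact Hy.
        assert (Hpy : (0 < Cmod y ^ N)%R) by (apply pow_lt, Cmod_gt_0, Hy).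
        apply Rmult_le_reg_r with (Cmod y ^ N)%R. exact Hpy.
        rewrite Rmult_assoc, Rinv_l, Rmult_1_r by lra. apply Hd, Hyd.
      - split. lra. exact Hzn. }
    rewrite HFm in HFz by exact Hzn.
    assert (Hpz : (0 < Cmod z ^ N)%R) by (apply pow_lt, Cmod_gt_0, Hzn).
    apply Rmult_le_compat_r with (r := (Cmod z ^ N)%R) in HFz. 2: lra.
    rewrite Rmult_assoc, Rinv_l, Rmult_1_r in HFz by lra.
    unfold Rdiv. rewrite Rpow_mult_distr, pow_inv. lra. }
intros eps He.
assert (Hx : (0 <= Cmod z / r1 < 1)%R).
{ split. apply Rmult_le_pos. lra. apply Rlt_le, Rinv_0_lt_compat. lra.
  apply Rmult_lt_reg_r with r1. lra. unfold Rdiv. rewrite Rmult_assoc, Rinv_l; lra. }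
destruct (pow_lt_1_zero (Cmod z / r1)) with (y := (eps / B)%R) as (N & HN).
{ rewrite Rabs_pos_eq; lra. }
{ apply Rdiv_lt_0_compat; lra. }
exists (S N). intros [|n] Hn. lia.
rewrite Cmod_sub_sym. eapply Rle_lt_trans. apply Hrem.
specialize (HN (S n) ltac:(lia)). rewrite Rabs_pos_eq in HN by (apply pow_le; lra).
apply Rmult_lt_compat_l with (r := B) in HN. 2: exact HB.
replace (B * (eps / B))%R with eps in HN by (field; lra). exact HN.
Qed.

(** Translate a point of [U] to the origin and expand there. *)
Theorem Ck_analytic (U : C -> Prop) (f : C -> C) : copen U -> (forall n, Ck n U f) -> analytic_on U f.
Proof.
intros HU Hf z0 Hz0.
destruct (HU z0 Hz0) as (r & Hr).
exists (taylor (fun h => f (1 * h + z0))), r.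
intros z Hz. apply is_pseries_climit.
replace (f z) with ((fun h => f (1 * h + z0)) (z - z0)) by (f_equal; ring).
apply (taylor_series_converges (fun h => f (1 * h + z0)) r). 2: exact Hz.
intros n. apply (Ck_subset n (fun h => U (1 * h + z0))).
- intros h Hh. apply Hr. replace (1 * h + z0 - z0) with h by ring. exact Hh.
- apply Ck_affine. exact HU. apply Hf. apply copen_affine, HU.
Qed.

(** * Complex exponential and logarithm *)

Lemma Cexp_plus a b : Cexp (a + b) = Cexp a * Cexp b.
Proof.
destruct a as [a1 a2], b as [b1 b2]. unfold Cexp, Cmult, Cplus. simpl.
rewrite exp_plus, cos_plus, sin_plus. f_equal; ring.
Qed.

Lemma Cexp_0 : Cexp 0 = 1.
Proof. unfold Cexp. simpl. rewrite exp_0, cos_0, sin_0. unfold RtoC. f_equal; ring. Qed.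

Lemma Cmod_Cexp z : Cmod (Cexp z) = exp (Re z).
Proof.
unfold Cexp, Cmod. simpl.
replace (exp (Re z) * cos (Im z) * (exp (Re z) * cos (Im z) * 1) +
         exp (Re z) * sin (Im z) * (exp (Re z) * sin (Im z) * 1))%R with (exp (Re z) ^ 2)%R.
- apply sqrt_pow2. left. apply exp_pos.
- pose proof (sin2_cos2 (Im z)) as H. unfold Rsqr in H.
  transitivity (exp (Re z) ^ 2 * (sin (Im z) * sin (Im z) + cos (Im z) * cos (Im z)))%R.
  rewrite H. ring. ring.
Qed.

Lemma exp_second_order x : (Rabs x <= 1 / 2)%R -> (Rabs (exp x - 1 - x) <= 2 * x ^ 2)%R.
Proof.
intros Hx. apply Rabs_le_between in Hx.
pose proof (exp_ineq1_le x) as H1. pose proof (exp_ineq1_le (- x)) as H2.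
assert (H3 : (exp x * exp (- x) = 1)%R) by (rewrite <- exp_plus, Rplus_opp_r; apply exp_0).
assert (H4 : (exp x * (1 - x) <= 1)%R).
{ pose proof (exp_pos x). assert (exp x * (1 + - x) <= exp x * exp (- x))%R by (apply Rmult_le_compat_l; lra). lra. }
assert (H5 : (exp x <= 1 + x + 2 * x ^ 2)%R).
{ apply Rmult_le_reg_r with (1 - x)%R. lra. eapply Rle_trans. exact H4.
  assert (0 <= x ^ 2 * (1 - 2 * x))%R by (apply Rmult_le_pos; [apply pow2_ge_0 | lra]). nra. }
apply Rabs_le. lra.
Qed.

Lemma cos_second_order y : (Rabs (cos y - 1) <= y ^ 2)%R.
Proof.
replace y with (2 * (y / 2))%R at 1 by field. rewrite cos_2a_sin.
assert (H : (Rabs (sin (y / 2)) <= Rabs (y / 2))%R).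
{ destruct (MVT_abs sin cos 0 (y / 2)) as (c & Hc & _).
  - intros x _. apply derivable_pt_lim_sin.
  - rewrite sin_0, !Rminus_0_r in Hc. rewrite Hc.
    pose proof (COS_bound c). assert (Rabs (cos c) <= 1)%R by (apply Rabs_le; lra).
    pose proof (Rabs_pos (y / 2)). nra. }
apply Rsqr_le_abs_1 in H. unfold Rsqr in H.
apply Rabs_le. nra.
Qed.

Lemma sin_second_order y : (Rabs y <= 1)%R -> (Rabs (sin y - y) <= y ^ 2)%R.
Proof.
intros Hy.
destruct (MVT_abs (fun t => sin t - t)%R (fun t => cos t - 1)%R 0 y) as (c & Hc & Hcy).
- intros t _. apply is_derive_Reals. auto_derive. trivial. ring.
- rewrite sin_0 in Hc. replace (sin y - y - (0 - 0))%R with (sin y - y)%R in Hc by ring.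
  rewrite Hc, Rminus_0_r.
  assert (Hc1 : (Rabs c <= Rabs y)%R).
  { revert Hcy. unfold Rmin, Rmax, Rabs. repeat destruct Rle_dec; repeat destruct Rcase_abs; lra. }
  pose proof (cos_second_order c) as Hcos.
  assert (Hsq : (c ^ 2 <= Rabs y ^ 2)%R).
  { rewrite <- (pow2_abs c). apply pow_incr. split. apply Rabs_pos. exact Hc1. }
  rewrite <- (pow2_abs y). pose proof (Rabs_pos y).
  assert (Rabs (cos c - 1) * Rabs y <= Rabs y ^ 2 * Rabs y)%R by (apply Rmult_le_compat_r; lra). nra.
Qed.

(** By the addition formula only the derivative at 0 matters.  There
    [e^k - 1 - k], for [k = x + i y], splits into
    [e^x (cos y - 1 + i (sin y - y))], [e^x - 1 - x] and [i y (e^x - 1)], each of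
    second order. *)
Lemma cder_Cexp z : cder Cexp z (Cexp z).
Proof.
apply (cder_quadratic _ z _ (Cmod (Cexp z) * 10) (1 / 2)). lra.
intros y Hy. set (k := y - z) in *.
replace (Cexp y) with (Cexp z * Cexp k) by (rewrite <- Cexp_plus; f_equal; unfold k; ring).
replace (Cexp z * Cexp k - Cexp z - k * Cexp z) with (Cexp z * (Cexp k - 1 - k)) by ring.
rewrite Cmod_mult, Rmult_assoc. apply Rmult_le_compat_l. apply Cmod_ge_0.
clearbody k. clear y.
pose proof (re_le_Cmod k) as Hx. pose proof (im_le_Cmod k) as Hyy.
pose proof (Cmod_ge_0 k) as Hk.
destruct k as [x y]. simpl in Hx, Hyy.
set (m := Cmod (x, y)) in *.
replace (Cexp (x, y) - 1 - (x, y)) with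
  (RtoC (exp x) * (RtoC (cos y - 1) + Ci * RtoC (sin y - y)) + RtoC (exp x - 1 - x)
    + Ci * RtoC (y * (exp x - 1))).
2:{ unfold Cexp, RtoC, Ci, Cminus, Cplus, Copp, Cmult. simpl. f_equal; ring. }
assert (Hx2 : (x ^ 2 <= m ^ 2)%R) by (rewrite <- pow2_abs; apply pow_incr; split; [apply Rabs_pos | exact Hx]).
assert (Hy2 : (y ^ 2 <= m ^ 2)%R) by (rewrite <- (pow2_abs y); apply pow_incr; split; [apply Rabs_pos | exact Hyy]).
pose proof (exp_second_order x ltac:(lra)) as He.
pose proof (cos_second_order y) as Hc.
pose proof (sin_second_order y ltac:(lra)) as Hs.
assert (He3 : (0 < exp x <= 3)%R).
{ split. apply exp_pos. eapply Rle_trans. 2: apply exp_le_3. apply Rlt_le, exp_increasing.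
  apply Rabs_le_between in Hx. lra. }
assert (He1 : (Rabs (exp x - 1) <= 2 * m)%R).
{ replace (exp x - 1)%R with ((exp x - 1 - x) + x)%R by ring. eapply Rle_trans. apply Rabs_triang. nra. }
eapply Rle_trans. apply Cmod_triangle. eapply Rle_trans. apply Rplus_le_compat_r, Cmod_triangle.
rewrite !Cmod_mult, Cmod_Ci, !Cmod_R, Rabs_mult, (Rabs_pos_eq (exp x)) by lra.
assert (H1 : (Cmod (RtoC (cos y - 1) + Ci * RtoC (sin y - y)) <= 2 * m ^ 2)%R).
{ eapply Rle_trans. apply Cmod_triangle. rewrite Cmod_mult, Cmod_Ci, !Cmod_R. lra. }
assert (H2 : (exp x * Cmod (RtoC (cos y - 1) + Ci * RtoC (sin y - y)) <= 3 * (2 * m ^ 2))%R).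
{ apply Rmult_le_compat; try lra. apply Cmod_ge_0. }
assert (H3 : (Rabs y * Rabs (exp x - 1) <= m * (2 * m))%R).
{ apply Rmult_le_compat; try lra; apply Rabs_pos. }
nra.
Qed.

Definition log_coef (n : nat) : C :=
  match n with O => 0 | S m => (-1) ^ m / RtoC (INR (S m)) end.

Lemma Cmod_pow_m1 m : Cmod ((-1) ^ m) = 1%R.
Proof. rewrite Cmod_pow. replace (Cmod (-1)) with 1%R. apply pow1.
rewrite Cmod_R, Rabs_left; lra. Qed.

(** The series of [log (1 + u)].  Its derivative is a geometric series, hence
    [1 / (1 + u)]; so [(1 + u) exp (- L u)] has zero derivative and is
    constant.  The coefficients have modulus at most 1, which gives the bound by
    comparison with a geometric series. *)
Lemma complex_log : exists L : C -> C, forall u, (Cmod u < 1)%R ->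
  cder L u (/ (1 + u)) /\ Cexp (L u) = 1 + u /\ (Cmod (L u) <= Cmod u / (1 - Cmod u))%R.
Proof.
assert (Hco : forall m, (Cmod (log_coef (S m)) <= 1)%R).
{ intros m. change (log_coef (S m)) with ((-1) ^ m / RtoC (INR (S m))). rewrite Cmod_div by apply INR_S_neq0. rewrite Cmod_pow_m1, Cmod_INR.
  unfold Rdiv. rewrite Rmult_1_l. rewrite <- Rinv_1. apply Rinv_le_contravar. lra.
  rewrite S_INR. pose proof (pos_INR m). lra. }
assert (Hex : forall u, exists l, (Cmod u < 1)%R -> climit (csum (fun k => log_coef k * u ^ k)) l).
{ intros u. destruct (Rlt_le_dec (Cmod u) 1) as [Hu|Hu].
  - destruct (climit_of_abs_convergent (fun k => log_coef k * u ^ k)) as (l & Hl).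
    + apply (ex_series_le (K := R_AbsRing) (V := R_CompleteNormedModule) _ (fun k => Cmod u ^ k)%R).
      * intros n. change (Rabs (Cmod (log_coef n * u ^ n)) <= Cmod u ^ n)%R.
        rewrite Rabs_pos_eq by apply Cmod_ge_0. rewrite Cmod_mult, Cmod_pow.
        rewrite <- (Rmult_1_l (Cmod u ^ n)) at 2. apply Rmult_le_compat_r. apply pow_le, Cmod_ge_0.
        destruct n as [|m]. simpl. rewrite Cmod_0. lra. apply Hco.
      * apply ex_series_geom. rewrite Rabs_pos_eq. exact Hu. apply Cmod_ge_0.
    + exists l. intros _. exact Hl.
  - exists 0. intros H. lra. }
destruct (choice _ Hex) as (L & HL).
assert (Hder : forall u, (Cmod u < 1)%R -> cder L u (/ (1 + u))).
{ intros u Hu.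
  assert (Hu1 : 1 + u <> 0).
  { intros H. assert (u = -1) by (replace u with ((1 + u) + (-1)) by ring; rewrite H; ring).
    subst u. rewrite Cmod_R, Rabs_left in Hu; lra. }
  destruct (pseries_cder log_coef L 1 HL u Hu) as (l & Hl1 & Hl2).
  apply cder_eq with l. exact Hl1.
  assert (Hl3 : (1 + u) * l = 1).
  { apply (climit_unique (fun n => (1 + u) * csum (fun k => coef_derive log_coef k * u ^ k) n)).
    - apply climit_scal, Hl2.
    - apply climit_ext with (fun n => 1 + (-1) * (-u) ^ n).
      + intros n. rewrite (csum_ext _ (fun k => (- u) ^ k)).
        * pose proof (csum_geom (- u) n) as Hg.
          replace ((1 + u) * csum (fun k => (- u) ^ k) n) with (- ((- u - 1) * csum (fun k => (- u) ^ k) n)) by ring.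
          rewrite Hg. ring.
        * intros k _. unfold coef_derive. change (log_coef (S k)) with ((-1) ^ k / RtoC (INR (S k))).
          replace (- u) with ((-1) * u) by ring. rewrite Cpow_mult_l.
          pose proof (INR_S_neq0 k). field. assumption.
      + intros eps He. destruct (pow_lt_1_zero (Cmod u)) with (y := eps) as (N & HN).
        rewrite Rabs_pos_eq; [exact Hu | apply Cmod_ge_0]. exact He.
        exists N. intros n Hn. replace (1 + -1 * (- u) ^ n - 1) with (- ((- u) ^ n)) by ring.
        rewrite Cmod_opp, Cmod_pow, Cmod_opp. specialize (HN n Hn).
        rewrite Rabs_pos_eq in HN by (apply pow_le, Cmod_ge_0). exact HN. }
  replace l with (/ (1 + u) * ((1 + u) * l)) by (field; exact Hu1). rewrite Hl3. ring. }
assert (Hb : forall u, (Cmod u < 1)%R -> (Cmod (L u) <= Cmod u / (1 - Cmod u))%R).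
{ intros u Hu. assert (Hu0 := Cmod_ge_0 u).
  apply (climit_bound (fun n => csum (fun k => log_coef k * u ^ k) (S n))). apply climit_S, HL, Hu.
  intros n. rewrite csum_shift.
  replace (log_coef 0 * u ^ 0 + csum (fun k => log_coef (S k) * u ^ S k) n) with
    (csum (fun k => log_coef (S k) * u ^ S k) n) by (simpl; ring).
  eapply Rle_trans. apply Cmod_csum.
  apply Rle_trans with (rsum (fun k => Cmod u * Cmod u ^ k)%R n).
  - apply rsum_le. intros k _. rewrite Cmod_mult, Cmod_pow.
    change (Cmod u * Cmod u ^ k)%R with (Cmod u ^ S k)%R.
    rewrite <- (Rmult_1_l (Cmod u ^ S k)) at 2. apply Rmult_le_compat_r. apply pow_le, Hu0. apply Hco.
  - rewrite rsum_scal. apply Rmult_le_compat_l. exact Hu0. apply rsum_geom_le. lra. }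
exists L. intros u Hu. split; [apply Hder, Hu | split; [|apply Hb, Hu]].
set (phi := fun v => (1 + v) * Cexp ((-1) * L v)).
assert (Hphi : phi u = 1).
{ assert (HL0 : L 0 = 0).
  { apply Cmod_eq_0. pose proof (Hb 0) as H. rewrite Cmod_0 in H. specialize (H Rlt_0_1).
    unfold Rdiv in H. rewrite Rmult_0_l in H. pose proof (Cmod_ge_0 (L 0)). lra. }
  assert (H0 : phi 0 = 1).
  { unfold phi. rewrite HL0. replace (-1 * 0) with (RtoC 0) by ring. rewrite Cexp_0. ring. }
  pose proof (mean_value_bound phi (fun _ => 0) u 0) as Hm. rewrite Rmult_0_l in Hm.
  assert (Hz : phi u - phi 0 = 0).
  { apply Cmod_eq_0. apply Rle_antisym. 2: apply Cmod_ge_0. apply Hm. clear Hm.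
    intros t Ht. rewrite Cmod_0. split; [|lra].
    set (v := RtoC t * u).
    assert (Hv : (Cmod v < 1)%R).
    { unfold v. rewrite Cmod_mult, Cmod_R, Rabs_pos_eq by lra. pose proof (Cmod_ge_0 u). nra. }
    assert (Hv1 : 1 + v <> 0).
    { intros H. assert (v = -1) by (replace v with ((1 + v) + (-1)) by ring; rewrite H; ring).
      rewrite H1, Cmod_R, Rabs_left in Hv; lra. }
    apply cder_eq with ((0 + 1) * Cexp ((-1) * L v) + (1 + v) * ((0 * L v + (-1) * / (1 + v)) * Cexp ((-1) * L v))).
    - apply (cder_mult (fun v => 1 + v) (fun v => Cexp ((-1) * L v))).
      + apply (cder_plus (fun _ => 1) (fun v => v)). apply cder_const. apply cder_id.
      + apply (cder_comp Cexp (fun v => (-1) * L v)). apply cder_Cexp.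
        apply (cder_mult (fun _ => -1) L). apply cder_const. apply Hder, Hv.
    - field. exact Hv1. }
  replace (phi u) with ((phi u - phi 0) + phi 0) by ring. rewrite Hz, H0. ring. }
replace (Cexp (L u)) with (Cexp (L u) * phi u) by (rewrite Hphi; ring).
unfold phi. replace (Cexp (L u) * ((1 + u) * Cexp (-1 * L u))) with ((1 + u) * (Cexp (L u) * Cexp (-1 * L u))) by ring.
rewrite <- Cexp_plus. replace (L u + -1 * L u) with (RtoC 0) by ring. rewrite Cexp_0. ring.
Qed.

(** * The differential operator on coefficients *)

Definition power_series_on (R0 : R) (a : nat -> C) (f : C -> C) : Prop :=
  forall z, (Cmod z < R0)%R -> climit (csum (fun k => a k * z ^ k)) (f z).

Lemma power_series_C_derive R0 a f : power_series_on R0 a f ->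
  power_series_on R0 (coef_derive a) (C_derive f).
Proof.
intros H z Hz. destruct (pseries_cder a f R0 H z Hz) as (l & Hl1 & Hl2).
rewrite (cder_unique _ _ _ Hl1). exact Hl2.
Qed.

(** Uniqueness of power series coefficients, by differentiating both the
    function and its expansion. *)
Lemma power_series_taylor n : forall R0 a f, (0 < R0)%R -> power_series_on R0 a f ->
  taylor f n = a n.
Proof.
induction n as [|n IH]; intros R0 a f HR H.
- simpl. apply (climit_unique (fun N => csum (fun k => a k * 0 ^ k) (S N))).
  + apply climit_S, H. rewrite Cmod_0. exact HR.
  + apply climit_ext with (fun _ => a O). intros N. symmetry. apply (psum_0 a N).
    intros eps He. exists O. intros k _. replace (a O - a O) with (RtoC 0) by ring. rewrite Cmod_0. exact He.
- change (taylor f (S n)) with (taylor (C_derive f) n / RtoC (INR (S n))).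
  rewrite (IH R0 (coef_derive a) (C_derive f) HR). 2: apply power_series_C_derive, H.
  unfold coef_derive. pose proof (INR_S_neq0 n). field. assumption.
Qed.

Definition coef_shift (a : nat -> C) (n : nat) : C := match n with O => 0 | S m => a m end.

Lemma power_series_shift R0 a f : power_series_on R0 a f ->
  power_series_on R0 (coef_shift a) (fun z => z * f z).
Proof.
intros H z Hz. apply climit_shift.
apply climit_ext with (fun n => z * csum (fun k => a k * z ^ k) n).
- intros n. rewrite csum_shift, <- csum_scal. simpl coef_shift.
  replace (0 * z ^ 0) with (RtoC 0) by ring. rewrite Cplus_0_l.
  apply csum_ext. intros k _. rewrite Cpow_S. ring.
- apply climit_scal, H, Hz.
Qed.

Lemma power_series_plus R0 a b f g : power_series_on R0 a f -> power_series_on R0 b g ->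
  power_series_on R0 (fun n => a n + b n) (fun z => f z + g z).
Proof.
intros Hf Hg z Hz.
apply climit_ext with (fun n => csum (fun k => a k * z ^ k) n + csum (fun k => b k * z ^ k) n).
- intros n. rewrite <- csum_plus. apply csum_ext. intros; ring.
- apply climit_plus. apply Hf, Hz. apply Hg, Hz.
Qed.

Lemma power_series_scal R0 c a f : power_series_on R0 a f ->
  power_series_on R0 (fun n => c * a n) (fun z => c * f z).
Proof.
intros Hf z Hz.
apply climit_ext with (fun n => c * csum (fun k => a k * z ^ k) n).
- intros n. rewrite <- csum_scal. apply csum_ext. intros; ring.
- apply climit_scal, Hf, Hz.
Qed.

Lemma power_series_ext R0 a b f g : (forall n, a n = b n) -> (forall z, f z = g z) ->
  power_series_on R0 a f -> power_series_on R0 b g.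
Proof.
intros Hab Hfg H z Hz. rewrite <- Hfg.
apply climit_ext with (csum (fun k => a k * z ^ k)).
intros n. apply csum_ext. intros k _. rewrite Hab. reflexivity. apply H, Hz.
Qed.

(** The eigenvalue of [euler_operator] on the monomial [z^n]. *)
Definition euler_symbol (g1 g2 g3 : R) (n : nat) : R :=
  (1 + g1 * INR n + g2 * (INR n * (INR n - 1)) + g3 * (INR n * (INR n - 1) * (INR n - 2)))%R.

Definition euler_operator (g1 g2 g3 : R) (p : C -> C) (z : C) : C :=
  p z + RtoC g1 * z * C_derive p z + RtoC g2 * z ^ 2 * C_derive (C_derive p) z
  + RtoC g3 * z ^ 3 * C_derive (C_derive (C_derive p)) z.

Lemma power_series_euler R0 g1 g2 g3 a p : power_series_on R0 a p ->
  power_series_on R0 (fun n => RtoC (euler_symbol g1 g2 g3 n) * a n) (euler_operator g1 g2 g3 p).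
Proof.
intros H.
pose proof (power_series_C_derive _ _ _ H) as H1.
pose proof (power_series_C_derive _ _ _ H1) as H2.
pose proof (power_series_C_derive _ _ _ H2) as H3.
apply power_series_shift in H1.
do 2 apply power_series_shift in H2.
do 3 apply power_series_shift in H3.
apply (power_series_scal _ (RtoC g1)) in H1.
apply (power_series_scal _ (RtoC g2)) in H2.
apply (power_series_scal _ (RtoC g3)) in H3.
pose proof (power_series_plus _ _ _ _ _ (power_series_plus _ _ _ _ _ (power_series_plus _ _ _ _ _ H H1) H2) H3) as Hs.
revert Hs. apply power_series_ext.
- intros [|[|[|n]]]; unfold coef_shift, coef_derive, euler_symbol.
  + simpl INR. rewrite !RtoC_plus, !RtoC_mult, !RtoC_minus. ring.
  + simpl INR. rewrite !RtoC_plus, !RtoC_mult, !RtoC_minus. ring.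
  + simpl INR. rewrite !RtoC_plus, !RtoC_mult, !RtoC_minus, ?RtoC_plus. ring.
  + rewrite !(S_INR (S _)), !S_INR, !RtoC_plus, !RtoC_mult, !RtoC_minus, !RtoC_plus. ring.
- intros z. unfold euler_operator. ring.
Qed.

Lemma euler_symbol_lower g1 g2 g3 n : (10 <= g1)%R -> (0 <= g2)%R -> (0 <= g3)%R ->
  (10 * INR (S n) <= euler_symbol g1 g2 g3 (S n))%R.
Proof.
intros H1 H2 H3. unfold euler_symbol.
assert (Hn := pos_INR n).
assert (Ha : (0 <= INR (S n) * (INR (S n) - 1))%R) by (rewrite S_INR; nra).
assert (Hb : (0 <= INR (S n) * (INR (S n) - 1) * (INR (S n) - 2))%R).
{ destruct n as [|m]. simpl. lra.
  apply Rmult_le_pos. exact Ha. rewrite !S_INR. pose proof (pos_INR m). lra. }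
assert (0 <= INR (S n))%R by apply pos_INR.
nra.
Qed.

Lemma Ck_euler n U g1 g2 g3 p : copen U -> (forall m, Ck m U p) -> Ck n U (euler_operator g1 g2 g3 p).
Proof.
intros HU Hp. unfold euler_operator.
repeat first [ apply Ck_plus | apply Ck_mult | exact HU | apply Ck_const | apply Ck_pow | apply Ck_id ].
- apply Hp.
- apply (Hp (S n)).
- apply (Hp (S (S n))).
- apply (Hp (S (S (S n)))).
Qed.

(** Telescoping: [1 / (n+1)^2 <= 1/n - 1/(n+1)]. *)
Lemma inv_square_sum n : (rsum (fun k => match k with O => 0 | S _ => / INR k ^ 2 end) (S n) <= 2)%R.
Proof.
assert (H : forall n, (rsum (fun k => match k with O => 0 | S _ => / INR k ^ 2 end) (S (S n)) <= 2 - / INR (S n))%R).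
{ clear n. intros n. induction n as [|m IH].
  - simpl. rewrite !Rmult_1_r, !Rinv_1. lra.
  - change (rsum (fun k => match k with O => 0 | S _ => / INR k ^ 2 end) (S (S (S m))))%R with
      (rsum (fun k => match k with O => 0 | S _ => / INR k ^ 2 end) (S (S m)) + / INR (S (S m)) ^ 2)%R.
    rewrite (S_INR (S m)). set (x := INR (S m)) in *.
    assert (Hx : (0 < x)%R) by (apply lt_0_INR; lia).
    assert (/ (x + 1) ^ 2 <= / x - / (x + 1))%R.
    { replace (/ x - / (x + 1))%R with (/ (x * (x + 1)))%R by (field; lra).
      apply Rinv_le_contravar; nra. }
    lra. }
destruct n as [|n]. simpl. lra.
specialize (H n). assert (0 < / INR (S n))%R by (apply Rinv_0_lt_compat, lt_0_INR; lia). lra.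
Qed.

(** * The bound for p *)

(** The partial sums of [p - 1] at [z] are values of a coefficient functional of
    [euler_operator p - 1]: the weights [q_k = z^k / (c_k r^k)] undo the
    operator.  They have square sum at most
    [(|z| / (10 r))^2 * sum 1/k^2], and the radius [r] is taken above [9/10] so
    that this stays below [(|z| / 6)^2]. *)
Lemma euler_operator_inverse_bound (p : C -> C) (g1 g2 g3 : R) :
  (10 <= g1)%R -> (0 <= g2)%R -> (0 <= g3)%R ->
  (forall n, Ck n (disk 1) p) -> p 0 = 1 ->
  (forall z, (Cmod z < 1)%R -> (Cmod (euler_operator g1 g2 g3 p z - 1) <= 2)%R) ->
  forall z, (Cmod z < 1)%R -> (Cmod (p z - 1) <= Cmod z / 3)%R.
Proof.
intros H1 H2 H3 Hp Hp0 Hq z Hz.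
assert (Hz0 := Cmod_ge_0 z).
destruct (Ceq_dec z 0) as [->|Hzn].
{ rewrite Hp0. replace (1 - 1) with (RtoC 0) by ring. rewrite Cmod_0. lra. }
assert (Hzpos : (0 < Cmod z)%R) by (apply Cmod_gt_0, Hzn).
set (a := taylor p).
assert (Ha : power_series_on 1 a p) by (intros y Hy; apply (taylor_series_converges p 1 Hp y Hy)).
set (c := euler_symbol g1 g2 g3).
set (g := fun y => euler_operator g1 g2 g3 p y - 1).
assert (Hg : forall n, Ck n (disk 1) g).
{ intros n. unfold g. apply Ck_minus. apply copen_ball. apply Ck_euler. apply copen_ball. exact Hp.
  apply Ck_const, copen_ball. }
assert (Hcoef : forall n, taylor g (S n) = RtoC (c (S n)) * a (S n)).
{ intros n.
  transitivity (taylor (euler_operator g1 g2 g3 p) (S n)).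
  2: exact (power_series_taylor (S n) 1 _ _ Rlt_0_1 (power_series_euler 1 g1 g2 g3 a p Ha)).
  change (taylor (C_derive g) n / RtoC (INR (S n)) = taylor (C_derive (euler_operator g1 g2 g3 p)) n / RtoC (INR (S n))).
  f_equal.
  rewrite (power_series_taylor n 1 (taylor (C_derive (euler_operator g1 g2 g3 p))) (C_derive g)).
  reflexivity. exact Rlt_0_1.
  intros y Hy. 
  assert (Hd : C_derive g y = C_derive (euler_operator g1 g2 g3 p) y).
  { apply cder_unique. apply cder_eq with (C_derive (euler_operator g1 g2 g3 p) y + 0). 2: ring.
    apply (cder_plus (euler_operator g1 g2 g3 p) (fun _ => -(1))). 2: apply cder_const.
    apply (Ck_euler 1 (disk 1) g1 g2 g3 p (copen_ball 1) Hp). exact Hy. }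
  rewrite Hd. apply (taylor_series_converges _ 1). 2: exact Hy.
  intros m. apply (Ck_euler (S m) (disk 1) g1 g2 g3 p (copen_ball 1) Hp). }
set (r := ((9 + Cmod z) / 10)%R).
assert (Hr : (9 / 10 < r < 1 /\ Cmod z < r)%R) by (unfold r; lra).
assert (Hrpos : (0 < r)%R) by lra.
assert (HrC : RtoC r <> 0) by (intros E; apply RtoC_inj in E; lra).
set (q := fun k => match k with O => RtoC 0 | S _ => z ^ k / (RtoC (c k) * RtoC r ^ k) end).
assert (Hcpos : forall k, (0 < INR (S k) /\ 10 * INR (S k) <= c (S k))%R).
{ intros k. split. apply lt_0_INR. lia. apply euler_symbol_lower; assumption. }
assert (HcC : forall k, RtoC (c (S k)) <> 0).
{ intros k E. apply RtoC_inj in E. destruct (Hcpos k). lra. }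
assert (Hqle : forall k, (Cmod (q k) ^ 2 <= (Cmod z / r / 10) ^ 2 * match k with O => 0 | S _ => / INR k ^ 2 end)%R).
{ intros [|k].
  - unfold q. rewrite Cmod_0. simpl. lra.
  - destruct (Hcpos k) as (Hk1 & Hk2).
    rewrite <- pow_inv, <- Rpow_mult_distr. apply pow_incr. split. apply Cmod_ge_0.
    unfold q. rewrite Cmod_div by (apply Cmult_neq_0; [apply HcC | apply Cpow_nz, HrC]).
    rewrite Cmod_mult, !Cmod_pow, !Cmod_R, (Rabs_pos_eq r), (Rabs_pos_eq (c (S k))) by lra.
    set (x := (Cmod z / r)%R).
    assert (Hx : (0 <= x <= 1)%R).
    { unfold x. split. apply Rmult_le_pos. lra. apply Rlt_le, Rinv_0_lt_compat, Hrpos.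
      apply Rmult_le_reg_r with r. exact Hrpos. unfold Rdiv. rewrite Rmult_assoc, Rinv_l; lra. }
    replace (Cmod z ^ S k / (c (S k) * r ^ S k))%R with (x ^ S k * / c (S k))%R.
    2:{ unfold x, Rdiv. rewrite Rpow_mult_distr, pow_inv. field. split. apply pow_nonzero. lra. lra. }
    clearbody x.
    replace (x / 10 * / INR (S k))%R with (x * / (10 * INR (S k)))%R by (field; lra).
    apply Rmult_le_compat.
    + apply pow_le. lra.
    + apply Rlt_le, Rinv_0_lt_compat. lra.
    + apply Rle_trans with (x * 1)%R. 2: lra. simpl. apply Rmult_le_compat_l. lra.
      rewrite <- (pow1 k). apply pow_incr. lra.
    + apply Rinv_le_contravar; lra. }
assert (Hpart : forall n, (Cmod (psum a (S n) z - 1) <= Cmod z / 3)%R).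
{ intros n.
  assert (HA : psum a (S n) z - 1 = csum (fun k => q k * taylor g k * RtoC r ^ k) (S n)).
  { unfold psum. rewrite !csum_shift.
    replace (a O) with (RtoC 1) by (symmetry; exact Hp0).
    unfold q at 1. replace (1 * z ^ 0 + csum (fun k => a (S k) * z ^ S k) n - 1)
       with (csum (fun k => a (S k) * z ^ S k) n) by (simpl; ring).
    replace (0 * taylor g 0 * RtoC r ^ 0) with (RtoC 0) by ring. rewrite Cplus_0_l.
    apply csum_ext. intros k _. rewrite Hcoef. unfold q.
    pose proof (HcC k). pose proof (Cpow_nz _ (S k) HrC). set (rk := RtoC r ^ S k) in *.
    set (zk := z ^ S k). field. split; assumption. }
  rewrite HA. replace (Cmod z / 3)%R with (2 * (Cmod z / 6))%R by field.
  apply (coefficient_functional_bound g 1 r 2 (Cmod z / 6) q (S n)).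
  - lra.
  - exact Hg.
  - lra.
  - intros y Hy. apply Hq. lra.
  - lra.
  - eapply Rle_trans. apply rsum_le. intros k _. apply Hqle.
    rewrite rsum_scal.
    apply Rle_trans with ((Cmod z / r / 10) ^ 2 * 2)%R.
    + apply Rmult_le_compat_l. apply pow2_ge_0. apply inv_square_sum.
    + assert (Hi : (/ r <= 10 / 9)%R).
      { replace (10 / 9)%R with (/ (9 / 10))%R by field. apply Rinv_le_contravar; lra. }
      assert (Hi0 : (0 < / r)%R) by (apply Rinv_0_lt_compat, Hrpos).
      assert (Hi2 : (/ r * / r <= 10 / 9 * (10 / 9))%R) by (apply Rmult_le_compat; lra).
      replace ((Cmod z / r / 10) ^ 2 * 2)%R with (Cmod z ^ 2 * (/ r * / r * / 50))%R by (field; lra).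
      replace ((Cmod z / 6) ^ 2)%R with (Cmod z ^ 2 * / 36)%R by field.
      apply Rmult_le_compat_l. apply pow2_ge_0. lra. }
apply (climit_bound (fun n => psum a (S n) z + (-1))).
- replace (p z - 1) with (p z + (-1)) by ring. apply climit_plus. apply climit_S, Ha, Hz.
  intros eps He. exists O. intros k _. replace (-1 - -1) with (RtoC 0) by ring. rewrite Cmod_0. exact He.
- intros n. replace (psum a (S n) z + -1) with (psum a (S n) z - 1) by ring. apply Hpart.
Qed.

(** [|sin v|] is at most the hyperbolic cosine of the imaginary part of [v], which
    is at most [(1 + e) / 2 <= 2]. *)
Lemma Cmod_Csin_le v : (Cmod v < 1)%R -> (Cmod (Csin v) <= 2)%R.
Proof.
intros Hv. unfold Csin.
assert (H2 : RtoC 2 * Ci <> 0).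
{ intros E. apply (f_equal Cmod) in E. rewrite Cmod_mult, Cmod_Ci, Cmod_R, Cmod_0, Rabs_pos_eq in E; lra. }
rewrite Cmod_div, (Cmod_mult 2), Cmod_Ci, Cmod_R, (Rabs_pos_eq 2), Rmult_1_r by (assumption || lra).
apply Rmult_le_reg_r with 2%R. lra. unfold Rdiv. rewrite Rmult_assoc, Rinv_l by lra.
rewrite Rmult_1_r. eapply Rle_trans. apply Cmod_triangle_sub. rewrite !Cmod_Cexp.
assert (Hre : Re (Ci * v) = (- Im v)%R) by (destruct v; simpl; ring).
assert (Hre2 : Re (- (Ci * v)) = Im v) by (destruct v; simpl; ring).
rewrite Hre, Hre2.
pose proof (im_le_Cmod v) as Hi. assert (Hb : (- 1 <= Im v <= 1)%R) by (apply Rabs_le_between; lra).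
assert (Hexp : forall x, (0 <= x <= 1)%R -> (exp (- x) + exp x <= 4)%R).
{ intros x Hx.
  assert (exp (- x) <= 1)%R.
  { rewrite <- exp_0. destruct (Req_dec x 0) as [->|Hx0]. rewrite Ropp_0. lra.
    apply Rlt_le, exp_increasing. lra. }
  assert (exp x <= exp 1)%R.
  { destruct (Req_dec x 1) as [->|Hx1]. lra. apply Rlt_le, exp_increasing. lra. }
  pose proof exp_le_3. lra. }
destruct (Rle_lt_dec 0 (Im v)) as [Hs|Hs].
- pose proof (Hexp (Im v) ltac:(lra)). lra.
- pose proof (Hexp (- Im v)%R ltac:(lra)) as H. rewrite Ropp_involutive in H. lra.
Qed.

(** Since [e sinh 1 = (e^2 - 1) / 2], the first alternative gives
    [gamma1 >= e (e + 1) + (e^2 - 1) / 2], which exceeds 10 as soon as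
    [e >= (4/3)^3 = 64/27]; this last bound is [exp x >= 1 + x] at [1/3].  The
    second alternative contradicts [e > 1]. *)
Lemma gamma1_ge_10 (m k g1 g2 g3 : R) : (k >= m)%R -> (m >= 2)%R ->
  (g1 > 0)%R -> (g2 > 0)%R -> (g3 > 0)%R ->
    (g1 - g2 - m ^ 2 * g3 - 3 * m * (k - 1) * g3
       - exp 1 * (exp 1 + 1) >= exp 1 * sinh 1)%R
    \/
    (1 - exp 1 - exp 1 * (g1 + g2 + m ^ 2 * g3
       + 3 * m * (k - 1) * g3) >= exp 1 * sinh 1)%R -> (10 <= g1)%R.
Proof.
intros Hk Hm H1 H2 H3 H.
assert (Hs : (exp 1 * sinh 1 = (exp 1 ^ 2 - 1) / 2)%R).
{ unfold sinh. assert (E : (exp 1 * exp (- (1)) = 1)%R) by (rewrite <- exp_plus, Rplus_opp_r; apply exp_0). nra. }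
assert (He : (64 / 27 <= exp 1)%R).
{ replace 1%R with (/ 3 + (/ 3 + / 3))%R by field. rewrite !exp_plus.
  pose proof (exp_ineq1_le (/ 3)). assert (4 / 3 <= exp (/ 3))%R by lra.
  assert (16 / 9 <= exp (/ 3) * exp (/ 3))%R by nra. nra. }
assert (Ha : (0 <= m ^ 2 * g3)%R) by (apply Rmult_le_pos; [apply pow2_ge_0 | lra]).
assert (Hb : (0 <= 3 * m * (k - 1) * g3)%R).
{ apply Rmult_le_pos. apply Rmult_le_pos. lra. lra. lra. }
rewrite Hs in H. destruct H as [H|H].
- nra.
- exfalso. assert (0 <= exp 1 * (g1 + g2 + m ^ 2 * g3 + 3 * m * (k - 1) * g3))%R by (apply Rmult_le_pos; lra). nra.
Qed.

Theorem theorem4p1 :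
  forall (m k gamma1 gamma2 gamma3 : R),
    (k >= m)%R -> (m >= 2)%R ->
    (gamma1 > 0)%R -> (gamma2 > 0)%R -> (gamma3 > 0)%R ->
    (gamma1 - gamma2 - m ^ 2 * gamma3 - 3 * m * (k - 1) * gamma3
       - exp 1 * (exp 1 + 1) >= exp 1 * sinh 1)%R
    \/
    (1 - exp 1 - exp 1 * (gamma1 + gamma2 + m ^ 2 * gamma3
       + 3 * m * (k - 1) * gamma3) >= exp 1 * sinh 1)%R ->
  forall p : C -> C,
    analytic_on unit_disk p ->
    p (RtoC 0) = RtoC 1 ->
    subordinate
      (fun z : C =>
         (p z
          + RtoC gamma1 * z * C_derive p z
          + RtoC gamma2 * z ^ 2 * C_derive (C_derive p) z
          + RtoC gamma3 * z ^ 3 * C_derive (C_derive (C_derive p)) z)%C)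
      (fun z : C => (RtoC 1 + Csin z)%C) ->
    subordinate p Cexp.
Proof.
intros m k g1 g2 g3 Hk Hm H1 H2 H3 Hhyp p Hp Hp0 (v & _ & Hv & _ & _ & Hpv).
pose proof (gamma1_ge_10 m k g1 g2 g3 Hk Hm H1 H2 H3 Hhyp) as Hg1.
assert (Hsm : forall n, Ck n (disk 1) p) by (intros n; apply (analytic_Ck n unit_disk p Hp)).
assert (Hbound : forall z, (Cmod z < 1)%R -> (Cmod (p z - 1) <= Cmod z / 3)%R).
{ apply (euler_operator_inverse_bound p g1 g2 g3); try assumption; try lra.
  intros z Hz. assert (E : euler_operator g1 g2 g3 p z = 1 + Csin (v z)) by exact (Hpv z Hz).
  rewrite E.
  replace (1 + Csin (v z) - 1) with (Csin (v z)) by ring.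
  apply Cmod_Csin_le, Hv, Hz. }
destruct complex_log as (L & HL).
assert (Hu : forall z, (Cmod z < 1)%R -> (Cmod (p z - 1) < 1)%R).
{ intros z Hz. specialize (Hbound z Hz). lra. }
set (w := fun z => L (p z - 1)).
assert (Hw : forall z, (Cmod z < 1)%R -> (Cmod (w z) <= Cmod z)%R).
{ intros z Hz. destruct (HL _ (Hu z Hz)) as (_ & _ & Hle).
  specialize (Hbound z Hz). pose proof (Cmod_ge_0 z). pose proof (Cmod_ge_0 (p z - 1)).
  unfold w. eapply Rle_trans. exact Hle.
  apply Rmult_le_reg_r with (1 - Cmod (p z - 1))%R. lra.
  unfold Rdiv. rewrite Rmult_assoc, Rinv_l by lra. nra. }
exists w. split; [|split; [|split; [|split]]].
- apply Ck_analytic. apply copen_ball.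
  intros [|n]. exact I.
  apply (Ck_intro n (disk 1) w (fun z => C_derive p z * / p z)). apply copen_ball.
  + intros z Hz.
    replace (/ p z) with (/ (1 + (p z - 1))) by (f_equal; ring).
    apply (cder_comp L (fun z => p z - 1)). apply (HL _ (Hu z Hz)).
    apply cder_eq with (C_derive p z + 0). 2: ring.
    apply (cder_plus p (fun _ => -(1))). 2: apply cder_const.
    apply (Hsm 1%nat). exact Hz.
  + apply Ck_mult. apply copen_ball. apply (Hsm (S n)).
    apply Ck_inv. apply copen_ball. 2: apply Hsm.
    intros z Hz E. specialize (Hu z Hz). rewrite E in Hu.
    replace (0 - 1) with (- (1)) in Hu by ring. rewrite Cmod_m1 in Hu. lra.
- intros z Hz. unfold unit_disk in *. specialize (Hw z Hz). lra.
- apply Cmod_eq_0. specialize (Hw 0). rewrite Cmod_0 in Hw. specialize (Hw Rlt_0_1).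
  pose proof (Cmod_ge_0 (w 0)). lra.
- exact Hw.
- intros z Hz. destruct (HL _ (Hu z Hz)) as (_ & He & _). unfold w. rewrite He. ring.
Qed.
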